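(* Let $R$ be a commutative unital ring and let $H$ be an affine group scheme over $R$, identified with a commutative Hopf $R$-algebra $H$. Let $\mathrm{Lie}(H)$ be the internal (differential) Lie algebra of $H$ in the Cartesian tangent category $(\mathbf{Aff}_R,\mathbb T^\Omega)$. Under the equivalence $\mathrm{DO}(\mathbf{Aff}_R)\simeq\mathbf{Mod}_R^{\mathrm{op}}$, $\mathrm{Lie}(H)$ corresponds to an $R$-module $\mathfrak h$ with a coLie algebra structure, and the dual $\mathrm{Hom}_R(\mathfrak h,R)$, with the induced Lie algebra structure, is isomorphic as a Lie algebra to the Lie algebra $\mathrm{LIDer}(H)$ of left-invariant derivations of $H$.
   Context: Conventions. Composition is diagrammatic: $fg$ means first $f$, then $g$; $\langle f,g\rangle$ is pairing, $\pi_i$ are projections. The tangent category of affine schemes. $\mathbf{Aff}_R$ is identified with $\mathbf{cAlg}_R^{\mathrm{op}}$, the opposite of commutative unital $R$-algebras. Its tangent structure $\mathbb T^\Omega=(T,p,z,s,l,c)$: $TA=\mathrm{Sym}_A\Omega_A$ ($\Omega_A$ = Kähler differentials over $R$), i.e. the algebra generated by $a\in A$ and symbols $\mathrm da$ ($R$-linear in $a$, $\mathrm d1=0$, $\mathrm d(ab)=a\,\mathrm db+b\,\mathrm da$). As algebra maps (so in the direction opposite to $\mathbf{Aff}_R$): $p_A:A\to TA$, $a\mapsto a$; $z_A:TA\to A$, $a\mapsto a,\ \mathrm da\mapsto0$; $s_A:TA\to TA\otimes_ATA$, $\mathrm da\mapsto\mathrm da\otimes1+1\otimes\mathrm da$;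 $l_A:TTA\to TA$, $a\mapsto a$, $\mathrm da,\mathrm d'a\mapsto0$, $\mathrm d'\mathrm da\mapsto\mathrm da$; $c_A:TTA\to TTA$ fixes $a$ and $\mathrm d'\mathrm da$ and exchanges $\mathrm da$ and $\mathrm d'a$. Negation $n_A$: $\mathrm da\mapsto-\mathrm da$. Products in $\mathbf{Aff}_R$ are $\otimes_R$ and the terminal object is $R$. Differential objects. A differential object of a Cartesian tangent category is a commutative monoid object $(A,0,+)$ with $\hat p_A:TA\to A$ such that $z\hat p={!}0$, $s\hat p=(\hat p\times\hat p)+$, $T0\,\hat p=0$, $T{+}\,\hat p=(\hat p\times\hat p)+$, $l\,T\hat p\,\hat p=\hat p$ and $\langle p,\hat p\rangle:TA\cong A\times A$; $\mathrm{DO}(\mathbf{Aff}_R)$ denotes the category of differential objects and linear morphisms ($Tf\,\hat p=\hat p f$). The equivalence $\mathbf{Mod}_R^{\mathrm{op}}\simeq\mathrm{DO}(\mathbf{Aff}_R)$ sends $M$ to $\mathrm{Sym}_R(M)$ with, as algebra maps, $0:m\mapsto0$, $+:m\mapsto m\otimes1+1\otimes m$, $\hat p:m\mapsto\mathrm dm$. Under it, a bilinear bracket $\mathfrak g\times\mathfrak g\to\mathfrak g$ on $\mathfrak g=\mathrm{Sym}_R(\mathfrak h)$ corresponds to an $R$-linear map $\gamma:\mathfrak h\to\mathfrak h\otimes_R\mathfrak h$ (a coLie algebra structure), which induces on $\mathrm{Hom}_R(\mathfrak h,R)$ the Lie bracket $[\alpha,\beta](m)=(\alpha\otimes\beta)(\gamma(m))$.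 The internal Lie algebra of a group object $G$ in $\mathbf{Aff}_R$ (unit $\mathsf e$, multiplication $\mathsf m_G$). Its underlying object is the tangent space at the unit $\mathfrak g=T_{\mathsf e}G$, the pullback in $\mathbf{Aff}_R$ of $p_G:TG\to G$ along $\mathsf e$, with inclusion $\iota_{\mathsf e}:\mathfrak g\to TG$; its differential object structure has $0\,\iota_{\mathsf e}=\mathsf ez_G$, $+\,\iota_{\mathsf e}=(\iota_{\mathsf e}\times\iota_{\mathsf e})s_G$, and vertical lift $\lambda$ with $\lambda\,T\iota_{\mathsf e}=\iota_{\mathsf e}l_G$. For an object $A$, an $A$-PLIVF is a map $X:G\times A\to TG$ in $\mathbf{Aff}_R$ with $Xp_G=\pi_1$ and $(\mathsf m_G\times\mathrm{id}_A)X=(z_G\times X)\,T\mathsf m_G$. Each is $(\mathrm{id}_G\times\hat X)\omega$ for a unique $\hat X:A\to\mathfrak g$, where $\omega=(z_G\times\iota_{\mathsf e})\,T\mathsf m_G$. For $A$-PLIVFs, $[X,Y]=\{\langle X,\pi_2z_A\rangle\,TY-\langle Y,\pi_2z_A\rangle\,TX\,c_G\}$, where $f-g=\langle f,g\,n_{TG}\rangle s_{TG}$ and $\{f\}$ is the unique map with $f=\langle fp_{TG}z_{TG},\{f\}l_G\rangle\,Ts_G$. The bracket on $\mathfrak g$ is the unique map $[,]:\mathfrak g\times\mathfrak g\to\mathfrak g$ with $(\mathrm{id}_G\times[,])\omega=[\omega_1,\omega_2]$, $\omega_k=(\mathrm{id}_G\times\pi_k)\omega$; it is bilinear and makes $\mathfrak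 g=:\mathrm{Lie}(G)$ an internal Lie algebra. Left-invariant derivations. For a commutative Hopf algebra $H$ with comultiplication $\Delta$, $\mathrm{LIDer}(H)$ is the $R$-module of $R$-linear maps $\delta:H\to H$ with $\delta(xy)=x\delta(y)+y\delta(x)$ and $\Delta(\delta(x))=(\mathrm{id}_H\otimes\delta)(\Delta(x))$, with the commutator bracket. *)

(* Defs.v *)
From HB Require Import structures.
From mathcomp Require Import all_boot generic_quotient ssralg.
From mathcomp Require Import boolp functions.

Set Implicit Arguments.
Unset Strict Implicit.
Unset Printing Implicit Defensive.

Import GRing.Theory.
Local Open Scope ring_scope.
Local Open Scope quotient_scope.

(******************************************************************************)
(* The R-module Hom_R(M, N)                                                   *)
(******************************************************************************)

Section Hom.
Context (R : comPzRingType) (M N : lmodType R).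

Definition hom_pred : {pred M -> N} := fun f => `[< linear f >].

Lemma hom_submod_closed : submod_closed hom_pred.
Proof.
split=> [|a f g /asboolP lf /asboolP lg]; apply/asboolP => c u v.
  by rewrite scaler0 addr0.
have ZE (h : M -> N) x : (a *: h) x = a *: h x by [].
have DE (h k : M -> N) x : (h + k) x = h x + k x by [].
rewrite !DE !ZE lf lg !scalerDr !scalerA mulrC -!addrA; congr (_ + _).
by rewrite addrCA.
Qed.

HB.instance Definition _ :=
  GRing.isSubmodClosed.Build R (M -> N) hom_pred hom_submod_closed.

Record hom := Hom { hom_fun :> M -> N; hom_funP : hom_fun \in hom_pred }.

HB.instance Definition _ := [isSub for hom_fun].
HB.instance Definition _ := [Choice of hom by <:].
HB.instance Definition _ := [SubChoice_isSubLmodule of hom by <:].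

HB.instance Definition _ (f : hom) :=
  GRing.isLinear.Build R M N *:%R f (asboolW (hom_funP f)).

Definition mk_hom (f : M -> N) (fP : linear f) : hom := Hom (asboolT fP).

Lemma homP (f g : hom) : f =1 g -> f = g.
Proof. by move=> /funext efg; apply: val_inj. Qed.

Lemma hom_addE (f g : hom) x : (f + g) x = f x + g x.
Proof. by []. Qed.

Lemma hom_scaleE a (f : hom) x : (a *: f) x = a *: f x.
Proof. by []. Qed.

Lemma hom_oppE (f : hom) x : (- f) x = - f x.
Proof. by []. Qed.

Section HomElements.
Context (f : hom).
Lemma homD x y : f (x + y) = f x + f y. Proof. exact: linearD. Qed.
Lemma homB x y : f (x - y) = f x - f y. Proof. exact: linearB. Qed.
Lemma homZ a x : f (a *: x) = a *: f x. Proof. exact: linearZ_LR. Qed.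
Lemma hom0 : f 0 = 0. Proof. exact: linear0. Qed.
End HomElements.

End Hom.

Definition hom_id (R : comPzRingType) (M : lmodType R) : hom M M :=
  mk_hom (fun a u v => erefl (a *: u + v)).

(******************************************************************************)
(* The tensor product M ⊗_R N, by generators and relations                    *)
(******************************************************************************)

Section Tensor.
Context (R : comPzRingType) (M N : lmodType R).

Inductive tterm : Type :=
| TPure of M & N
| TZero
| TAdd of tterm & tterm
| TScale of R & tterm.

Inductive tcong : tterm -> tterm -> Prop :=
| tc_refl t : tcong t t
| tc_sym t u : tcong t u -> tcong u t
| tc_trans t u v : tcong t u -> tcong u v -> tcong t v
| tc_add t t' u u' : tcong t t' -> tcong u u' -> tcong (TAdd t u) (TAdd t' u')
| tc_scale a t t' : tcong t t' -> tcong (TScale a t) (TScale a t')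
| tc_addA t u v : tcong (TAdd t (TAdd u v)) (TAdd (TAdd t u) v)
| tc_addC t u : tcong (TAdd t u) (TAdd u t)
| tc_add0 t : tcong (TAdd TZero t) t
| tc_addN t : tcong (TAdd (TScale (-1) t) t) TZero
| tc_scaleA a b t : tcong (TScale a (TScale b t)) (TScale (a * b) t)
| tc_scale1 t : tcong (TScale 1 t) t
| tc_scaleDr a t u : tcong (TScale a (TAdd t u)) (TAdd (TScale a t) (TScale a u))
| tc_scaleDl a b t : tcong (TScale (a + b) t) (TAdd (TScale a t) (TScale b t))
| tc_pureDl m m' n : tcong (TPure (m + m') n) (TAdd (TPure m n) (TPure m' n))
| tc_pureDr m n n' : tcong (TPure m (n + n')) (TAdd (TPure m n) (TPure m n'))
| tc_pureZl a m n : tcong (TPure (a *: m) n) (TScale a (TPure m n))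
| tc_pureZr a m n : tcong (TPure m (a *: n)) (TScale a (TPure m n)).

HB.instance Definition _ := gen_eqMixin tterm.
HB.instance Definition _ := gen_choiceMixin tterm.

Definition tcongb : rel tterm := fun t u => `[< tcong t u >].

Lemma tcongb_refl : reflexive tcongb.
Proof. by move=> t; apply/asboolP/tc_refl. Qed.
Lemma tcongb_sym : symmetric tcongb.
Proof. by move=> t u; apply/asboolP/asboolP => /tc_sym. Qed.
Lemma tcongb_trans : transitive tcongb.
Proof.
by move=> u t v /asboolP tu /asboolP uv; apply/asboolP/(tc_trans tu uv).
Qed.

Canonical tcong_equiv := EquivRel tcongb tcongb_refl tcongb_sym tcongb_trans.

Definition tensor := {eq_quot tcong_equiv}.

HB.instance Definition _ := Choice.on tensor.

Definition tclass (t : tterm) : tensor := \pi_({eq_quot tcong_equiv}) t.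

Lemma tclassP t u : tcong t u -> tclass t = tclass u.
Proof. by move=> tu; rewrite /tclass; apply/eqmodP/asboolP. Qed.

Lemma tclass_repr (x : tensor) : tclass (repr x) = x.
Proof. exact: reprK. Qed.

Lemma repr_tclass t : tcong (repr (tclass t)) t.
Proof. by apply/asboolP; apply/(eqmodP tcong_equiv); exact: reprK. Qed.

Definition tens_add (x y : tensor) := tclass (TAdd (repr x) (repr y)).
Definition tens_scale a (x : tensor) := tclass (TScale a (repr x)).

Lemma tclassD t u : tclass (TAdd t u) = tens_add (tclass t) (tclass u).
Proof. by apply/tclassP/tc_add; apply/tc_sym/repr_tclass. Qed.

Lemma tclassZ a t : tclass (TScale a t) = tens_scale a (tclass t).
Proof. by apply/tclassP/tc_scale/tc_sym/repr_tclass. Qed.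

Lemma tens_ind1 (P : tensor -> Prop) :
  (forall t, P (tclass t)) -> forall x, P x.
Proof. by move=> Pt x; rewrite -(tclass_repr x). Qed.

Fact tens_addA : associative tens_add.
Proof.
move=> x y z; elim/tens_ind1: x => ?; elim/tens_ind1: y => ?.
by elim/tens_ind1: z => ?; rewrite -!tclassD; exact/tclassP/tc_addA.
Qed.
Fact tens_addC : commutative tens_add.
Proof.
move=> x y; elim/tens_ind1: x => ?; elim/tens_ind1: y => ?.
by rewrite -!tclassD; exact/tclassP/tc_addC.
Qed.
Fact tens_add0 : left_id (tclass TZero) tens_add.
Proof. by move=> x; elim/tens_ind1: x => ?; rewrite -!tclassD; exact/tclassP/tc_add0. Qed.
Fact tens_addN : left_inverse (tclass TZero) (tens_scale (-1)) tens_add.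
Proof.
by move=> x; elim/tens_ind1: x => ?; rewrite -tclassZ -tclassD; exact/tclassP/tc_addN. Qed.

HB.instance Definition _ :=
  GRing.isZmodule.Build tensor tens_addA tens_addC tens_add0 tens_addN.

Lemma tclass_add t u : tclass (TAdd t u) = tclass t + tclass u.
Proof. exact: tclassD. Qed.

Fact tens_scaleA a b x : tens_scale a (tens_scale b x) = tens_scale (a * b) x.
Proof. by elim/tens_ind1: x => ?; rewrite -!tclassZ; exact/tclassP/tc_scaleA. Qed.
Fact tens_scale1 : left_id 1 tens_scale.
Proof. by move=> x; elim/tens_ind1: x => ?; rewrite -!tclassZ; exact/tclassP/tc_scale1. Qed.
Fact tens_scaleDr : right_distributive tens_scale +%R.
Proof.
move=> a x y; elim/tens_ind1: x => ?; elim/tens_ind1: y => ?.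
by rewrite -tclass_add -!tclassZ -tclass_add; exact/tclassP/tc_scaleDr.
Qed.
Fact tens_scaleDl x : {morph tens_scale^~ x : a b / a + b}.
Proof.
move=> a b; elim/tens_ind1: x => ?.
by rewrite -!tclassZ -tclass_add; exact/tclassP/tc_scaleDl.
Qed.

HB.instance Definition _ := GRing.Zmodule_isLmodule.Build R tensor
  tens_scaleA tens_scale1 tens_scaleDr tens_scaleDl.

Definition tpure (m : M) (n : N) : tensor := tclass (TPure m n).

Lemma tpure_linearl n : linear (tpure^~ n).
Proof.
move=> a m m'; transitivity (tclass (TAdd (TScale a (TPure m n)) (TPure m' n))).
  apply/tclassP; apply: (tc_trans (tc_pureDl _ _ _)).
  by apply: tc_add; [exact: tc_pureZl | exact: tc_refl].
by rewrite tclassD tclassZ.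
Qed.

Lemma tpure_linearr m : linear (tpure m).
Proof.
move=> a n n'; transitivity (tclass (TAdd (TScale a (TPure m n)) (TPure m n'))).
  apply/tclassP; apply: (tc_trans (tc_pureDr _ _ _)).
  by apply: tc_add; [exact: tc_pureZr | exact: tc_refl].
by rewrite tclassD tclassZ.
Qed.

Lemma tpureDl m m' n : tpure (m + m') n = tpure m n + tpure m' n.
Proof. by have := tpure_linearl n 1 m m'; rewrite !scale1r. Qed.
Lemma tpureDr m n n' : tpure m (n + n') = tpure m n + tpure m n'.
Proof. by have := tpure_linearr m 1 n n'; rewrite !scale1r. Qed.
Lemma tpureZl a m n : tpure (a *: m) n = a *: tpure m n.
Proof. by rewrite [LHS](tclassP (tc_pureZl _ _ _)); exact: tclassZ. Qed.
Lemma tpureZr a m n : tpure m (a *: n) = a *: tpure m n.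
Proof. by rewrite [LHS](tclassP (tc_pureZr _ _ _)); exact: tclassZ. Qed.

Lemma tpure0r m : tpure m 0 = 0.
Proof. by have := tpureZr 0 m 0; rewrite !scale0r. Qed.

Lemma tpureBr m n n' : tpure m (n - n') = tpure m n - tpure m n'.
Proof. by rewrite tpureDr -[- n']scaleN1r tpureZr scaleN1r. Qed.

Lemma tensor_ind (P : tensor -> Prop) :
    (forall m n, P (tpure m n)) -> P 0 ->
    (forall x y, P x -> P y -> P (x + y)) ->
    (forall a x, P x -> P (a *: x)) ->
  forall x, P x.
Proof.
move=> Pp P0 PD PZ; elim/tens_ind1; elim=> [m n||t IHt u IHu|a t IHt].
- exact: Pp.
- exact: P0.
- by rewrite tclassD; exact: PD.
- by rewrite tclassZ; exact: PZ.
Qed.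

Section Lift.
Context (P : lmodType R).

Definition bilin (f : M -> N -> P) :=
  (forall n, linear (f^~ n)) /\ (forall m, linear (f m)).

Context (f : M -> N -> P) (fP : bilin f).

Fixpoint teval (t : tterm) : P :=
  match t with
  | TPure m n => f m n
  | TZero => 0
  | TAdd t u => teval t + teval u
  | TScale a t => a *: teval t
  end.

Lemma teval_cong t u : tcong t u -> teval t = teval u.
Proof.
have [fl fr] := fP.
elim=> //=.
- by move=> ? ? ? _ -> _ ->.
- by move=> ? ? ? ? _ -> _ ->.
- by move=> ? ? ? _ ->.
- by move=> *; rewrite addrA.
- by move=> *; rewrite addrC.
- by move=> *; rewrite add0r.
- by move=> *; rewrite scaleN1r addNr.
- by move=> *; rewrite scalerA.
- by move=> *; rewrite scale1r.
- by move=> *; rewrite scalerDr.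
- by move=> *; rewrite scalerDl.
- by move=> m m' n; have := fl n 1 m m'; rewrite !scale1r.
- by move=> m n n'; have := fr m 1 n n'; rewrite !scale1r.
- move=> a m n; have := fl n a m 0; rewrite !addr0 => ->.
  suff -> : f 0 n = 0 by rewrite addr0.
  by have := fl n (-1) 0 0; rewrite scaleN1r oppr0 addr0 scaleN1r addNr.
- move=> a m n; have := fr m a n 0; rewrite !addr0 => ->.
  suff -> : f m 0 = 0 by rewrite addr0.
  by have := fr m (-1) 0 0; rewrite scaleN1r oppr0 addr0 scaleN1r addNr.
Qed.

Definition tlift_fun (x : tensor) : P := teval (repr x).

Lemma tlift_class t : tlift_fun (tclass t) = teval t.
Proof. exact: teval_cong (repr_tclass t). Qed.

Lemma tlift_linear : linear tlift_fun.
Proof.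
move=> a x y; elim/tens_ind1: x => ?; elim/tens_ind1: y => ?.
by rewrite [_ *: tclass _]/GRing.scale /= -tclassZ -tclass_add !tlift_class.
Qed.

Definition tlift : hom tensor P := mk_hom tlift_linear.

Lemma tliftE m n : tlift (tpure m n) = f m n.
Proof. exact: tlift_class. Qed.

End Lift.

Lemma tensor_ext (P : lmodType R) (f g : hom tensor P) :
  (forall m n, f (tpure m n) = g (tpure m n)) -> f = g.
Proof.
move=> fg; apply: homP; elim/tensor_ind=> [//||x y fx fy|a x fx].
- by rewrite !linear0.
- by rewrite !linearD /= fx fy.
- by rewrite !linearZ_LR /= fx.
Qed.

End Tensor.

Arguments tpure {R M N}.

Definition tmap (R : comPzRingType) (M N M' N' : lmodType R)
    (f : hom M M') (g : hom N N') : hom (tensor M N) (tensor M' N').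
Proof.
refine (@tlift _ _ _ _ (fun m n => tpure (f m) (g n)) _).
by split=> [n a m m'|m a n n']; rewrite linearP;
   [exact: tpure_linearl | exact: tpure_linearr].
Defined.

Lemma tmapE (R : comPzRingType) (M N M' N' : lmodType R)
    (f : hom M M') (g : hom N N') m n :
  tmap f g (tpure m n) = tpure (f m) (g n).
Proof. exact: tliftE. Qed.

(******************************************************************************)
(* Commutative R-algebras, as commutative rings under R. MathComp's           *)
(* comAlgType is not used because it requires 1 != 0: nonzero algebras are    *)
(* not closed under ⊗, and R itself may be zero.                              *)
(******************************************************************************)

Record calg (R : comPzRingType) := CAlg {
  calg_sort :> comPzRingType;
  scal : {rmorphism R -> calg_sort}
}.

(* The underlying R-module. *)
Definition amod (R : comPzRingType) (A : calg R) : Type := A.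

Section AMod.
Context (R : comPzRingType) (A : calg R).

HB.instance Definition _ := GRing.ComPzRing.on (amod A).

Definition amod_scale (a : R) (x : amod A) : amod A := scal A a * (x : A).

Fact amod_scaleA a b x : amod_scale a (amod_scale b x) = amod_scale (a * b) x.
Proof. by rewrite /amod_scale rmorphM mulrA. Qed.
Fact amod_scale1 : left_id 1 amod_scale.
Proof. by move=> x; rewrite /amod_scale rmorph1 mul1r. Qed.
Fact amod_scaleDr : right_distributive amod_scale +%R.
Proof. by move=> a x y; rewrite /amod_scale mulrDr. Qed.
Fact amod_scaleDl x : {morph amod_scale^~ x : a b / a + b}.
Proof. by move=> a b; rewrite /amod_scale rmorphD mulrDl. Qed.

HB.instance Definition _ := GRing.Zmodule_isLmodule.Build R (amod A)
  amod_scaleA amod_scale1 amod_scaleDr amod_scaleDl.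

End AMod.

Lemma amodZ (R : comPzRingType) (A : calg R) (a : R) (x : amod A) :
  a *: x = scal A a * (x : A).
Proof. by []. Qed.

Lemma amod_mulr_linear (R : comPzRingType) (A : calg R) (a : A) :
  linear ( *%R a : amod A -> amod A).
Proof. by move=> c x y; rewrite !amodZ mulrDr (mulrCA a). Qed.

Lemma amod_mull_linear (R : comPzRingType) (A : calg R) (a : A) :
  linear (( *%R^~ a) : amod A -> amod A).
Proof. by move=> c x y; rewrite !amodZ mulrDl mulrA. Qed.

(******************************************************************************)
(* The category Aff_R. A morphism A ~> B is an algebra map B -> A, and        *)
(* composition is diagrammatic.                                               *)
(******************************************************************************)

Section Aff.
Context (R : comPzRingType).

Definition alg_morphism (A B : calg R) (f : A -> B) :=
  [/\ {morph f : x y / x + y}, {morph f : x y / x * y}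
    & forall a, f (scal A a) = scal B a].

Record aff (A B : calg R) := Aff {
  comap :> B -> A;
  comapP : alg_morphism comap
}.

Section AffMorphism.
Context (A B : calg R) (f : aff A B).

Fact comap_semi_additive : semi_additive (comap f).
Proof.
have [fD _ fs] := comapP f; split=> //.
by rewrite -(rmorph0 (scal B)) fs rmorph0.
Qed.

Fact comap_monoid_morphism : monoid_morphism (comap f).
Proof.
have [_ fM fs] := comapP f; split=> //.
by rewrite -(rmorph1 (scal B)) fs rmorph1.
Qed.

HB.instance Definition _ :=
  GRing.isSemiAdditive.Build B A (comap f) comap_semi_additive.
HB.instance Definition _ :=
  GRing.isMonoidMorphism.Build B A (comap f) comap_monoid_morphism.

Lemma comap_scal a : f (scal B a) = scal A a.
Proof. by have [] := comapP f. Qed.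

End AffMorphism.

Lemma affP (A B : calg R) (f g : aff A B) : f =1 g -> f = g.
Proof.
case: f g => f fP [g gP] /funext /= efg.
by move: gP; rewrite -efg => gP; congr Aff; exact: Prop_irrelevance.
Qed.

Definition aff_id (A : calg R) : aff A A :=
  @Aff A A id (And3 (fun _ _ => erefl) (fun _ _ => erefl) (fun _ => erefl)).

Definition aff_comp (A B C : calg R) (f : aff A B) (g : aff B C) : aff A C.
Proof.
refine (@Aff A C (fun x => f (g x)) _).
by split=> [x y|x y|a]; rewrite ?rmorphD ?rmorphM ?comap_scal.
Defined.

(* The R-linear map underlying an algebra map. *)
Definition comap_hom (A B : calg R) (f : aff A B) : hom (amod B) (amod A).
Proof.
refine (@mk_hom R (amod B) (amod A) (comap f) _).
by move=> a x y; have [fD fM fs] := comapP f; rewrite !amodZ -fs -fM; exact: fD.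
Defined.

(* The terminal object. *)
Definition aff1 : calg R := CAlg (idfun : {rmorphism R -> R}).

Definition aff_to1 (A : calg R) : aff A aff1 :=
  @Aff A aff1 (scal A)
    (And3 (rmorphD (scal A)) (rmorphM (scal A)) (fun _ => erefl)).

End Aff.

Arguments aff_id {R} A.
Arguments aff1 R : clear implicits.
Arguments aff_to1 {R} A.

Notation "A ~> B" := (aff A B) (at level 70, no associativity) : type_scope.
Notation "f ;; g" := (aff_comp f g) (at level 50, left associativity).

(******************************************************************************)
(* The algebra A ⊗_R B, product of A and B in Aff_R                           *)
(******************************************************************************)

Section TensorAlgebra.
Context (R : comPzRingType) (A B : calg R).

Definition talg : Type := tensor (amod A) (amod B).
HB.instance Definition _ := GRing.Lmodule.on talg.

Definition tpure_mul (a : A) (b : B) : hom talg talg.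
Proof.
refine (@tlift R (amod A) (amod B) talg
          (fun a' b' => tpure (a * a' : amod A) (b * b' : amod B)) _).
split=> [b'|a'] c x y.
  by rewrite amod_mulr_linear; exact: tpure_linearl.
by rewrite amod_mulr_linear; exact: tpure_linearr.
Defined.

Lemma tpure_mulE a b a' b' :
  tpure_mul a b (tpure (a' : amod A) (b' : amod B)) =
  tpure (a * a' : amod A) (b * b' : amod B).
Proof. exact: tliftE. Qed.

Definition talg_mul_hom : hom talg (hom talg talg).
Proof.
refine (@tlift R (amod A) (amod B) (hom talg talg) tpure_mul _).
split=> [b|a] c x y; apply: tensor_ext => a' b'.
  rewrite tpure_mulE amod_mull_linear tpure_linearl -!tpure_mulE; exact: erefl.
rewrite tpure_mulE amod_mull_linear tpure_linearr -!tpure_mulE; exact: erefl.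
Defined.

Definition talg_mul (x y : talg) : talg := talg_mul_hom x y.
Definition talg_one : talg := tpure (1 : amod A) (1 : amod B).

Lemma talg_mulE a b a' b' :
  talg_mul (tpure (a : amod A) (b : amod B)) (tpure (a' : amod A) (b' : amod B)) =
  tpure (a * a' : amod A) (b * b' : amod B).
Proof. by rewrite /talg_mul tliftE tpure_mulE. Qed.

Lemma talg_mulDl : left_distributive talg_mul +%R.
Proof. by move=> x y z; rewrite /talg_mul linearD. Qed.
Lemma talg_mulDr : right_distributive talg_mul +%R.
Proof. by move=> x y z; rewrite /talg_mul linearD. Qed.
Lemma talg_mul0l x : talg_mul 0 x = 0.
Proof. by rewrite /talg_mul linear0. Qed.
Lemma talg_mul0r x : talg_mul x 0 = 0.
Proof. by rewrite /talg_mul linear0. Qed.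
Lemma talg_mulZl c x y : talg_mul (c *: x) y = c *: talg_mul x y.
Proof. by rewrite /talg_mul linearZ_LR. Qed.
Lemma talg_mulZr c x y : talg_mul x (c *: y) = c *: talg_mul x y.
Proof. by rewrite /talg_mul linearZ_LR. Qed.

Fact talg_mulC : commutative talg_mul.
Proof.
move=> x y; elim/tensor_ind: x => [a b||x x' IH IH'|c x IH].
- elim/tensor_ind: y => [a' b'||y y' IH IH'|c y IH].
  + by rewrite !talg_mulE mulrC (mulrC b).
  + by rewrite talg_mul0l talg_mul0r.
  + by rewrite talg_mulDl talg_mulDr IH IH'.
  + by rewrite talg_mulZl talg_mulZr IH.
- by rewrite talg_mul0l talg_mul0r.
- by rewrite talg_mulDl talg_mulDr IH IH'.
- by rewrite talg_mulZl talg_mulZr IH.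
Qed.

Fact talg_mulA : associative talg_mul.
Proof.
move=> x y z; elim/tensor_ind: x => [a b||x x' IH IH'|c x IH].
- elim/tensor_ind: y => [a' b'||y y' IH IH'|c y IH].
  + elim/tensor_ind: z => [a'' b''||z z' IH IH'|c z IH].
    * by rewrite !talg_mulE !mulrA.
    * by rewrite !talg_mul0r.
    * by rewrite !talg_mulDr IH IH'.
    * by rewrite !talg_mulZr IH.
  + by rewrite !(talg_mul0l, talg_mul0r).
  + by rewrite !(talg_mulDl, talg_mulDr) IH IH'.
  + by rewrite !(talg_mulZl, talg_mulZr) IH.
- by rewrite !talg_mul0l.
- by rewrite !talg_mulDl IH IH'.
- by rewrite !talg_mulZl IH.
Qed.

Fact talg_mul1 : left_id talg_one talg_mul.
Proof.
elim/tensor_ind => [a b||x x' IH IH'|c x IH].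
- by rewrite talg_mulE !mul1r.
- by rewrite talg_mul0r.
- by rewrite talg_mulDr IH IH'.
- by rewrite talg_mulZr IH.
Qed.

HB.instance Definition _ := GRing.Zmodule_isComPzRing.Build talg
  talg_mulA talg_mulC talg_mul1 talg_mulDl.

Lemma talg_scaleE c (x : talg) : c *: x = (c *: (1 : talg)) * x.
Proof. by rewrite [RHS]talg_mulZl [talg_mul _ _]talg_mul1. Qed.

Definition talg_scal (a : R) : talg := a *: (1 : talg).

Fact talg_scal_semi_additive : semi_additive talg_scal.
Proof. by split=> [|a b]; rewrite /talg_scal ?scale0r ?scalerDl. Qed.
Fact talg_scal_monoid : monoid_morphism talg_scal.
Proof.
split=> [|a b]; rewrite /talg_scal ?scale1r //.
by rewrite [RHS]talg_mulZl [X in a *: X](mul1r (b *: (1 : talg))) scalerA.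
Qed.

HB.instance Definition _ :=
  GRing.isSemiAdditive.Build R talg talg_scal talg_scal_semi_additive.
HB.instance Definition _ :=
  GRing.isMonoidMorphism.Build R talg talg_scal talg_scal_monoid.

Definition prod : calg R := @CAlg R talg talg_scal.

Definition apure (a : A) (b : B) : prod := tpure (a : amod A) (b : amod B).

Lemma apureM a b a' b' : apure a b * apure a' b' = apure (a * a') (b * b').
Proof. exact: talg_mulE. Qed.

Lemma scal_prodl c : scal prod c = apure (scal A c) 1.
Proof. by rewrite -[scal A c]mulr1 [RHS](tpureZl c (1 : amod A)). Qed.

Lemma scal_prodr c : scal prod c = apure 1 (scal B c).
Proof. by rewrite -[scal B c]mulr1 [RHS](tpureZr c _ (1 : amod B)). Qed.

Definition pi1 : prod ~> A.
Proof.
refine (@Aff R prod A (fun a => apure a 1) _).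
split=> [x y|x y|a]; first exact: tpureDl.
- by rewrite apureM mulr1.
- by rewrite scal_prodl.
Defined.

Definition pi2 : prod ~> B.
Proof.
refine (@Aff R prod B (fun b => apure 1 b) _).
split=> [x y|x y|a]; first exact: tpureDr.
- by rewrite apureM mulr1.
- by rewrite scal_prodr.
Defined.

Lemma apureE a b : apure a b = pi1 a * pi2 b.
Proof. by rewrite apureM mulr1 mul1r. Qed.

Lemma prod_ext (X : calg R) (f g : X ~> prod) :
  f ;; pi1 = g ;; pi1 -> f ;; pi2 = g ;; pi2 -> f = g.
Proof.
move=> /(congr1 (@comap _ _ _)) e1 /(congr1 (@comap _ _ _)) e2; apply: affP.
have [fD fM fs] := comapP f; have [gD gM gs] := comapP g.
apply: tensor_ind => [a b||x y IHx IHy|c x IH].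
- rewrite -[tpure a b]/(apure a b) apureE !rmorphM.
  by congr (_ * _); [exact: (congr1 (@^~ a) e1) | exact: (congr1 (@^~ b) e2)].
- exact: etrans (rmorph0 f) (esym (rmorph0 g)).
- by rewrite [LHS]fD [RHS]gD IHx IHy.
- by rewrite [c *: x]talg_scaleE [LHS]fM [RHS]gM IH fs gs.
Qed.

Section Pairing.
Context (X : calg R) (f : X ~> A) (g : X ~> B).

Fact pair_bilin :
  bilin (fun (a : amod A) (b : amod B) => (f a * g b : amod X)).
Proof.
split=> [b|a] c x y; have [fD fM fs] := comapP f; have [gD gM gs] := comapP g.
  by rewrite !amodZ fD fM fs mulrDl mulrA.
by rewrite !amodZ gD gM gs mulrDr mulrCA.
Qed.

Definition pair_fun (x : prod) : X := tlift pair_bilin x.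

Lemma pair_apure a b : pair_fun (apure a b) = f a * g b.
Proof. exact: (tliftE pair_bilin). Qed.

Fact pair_morphism : @alg_morphism R prod X pair_fun.
Proof.
have fun0 : pair_fun 0 = 0 by exact: (linear0 (tlift pair_bilin)).
have funD u v : pair_fun (u + v) = pair_fun u + pair_fun v.
  exact: (linearD (tlift pair_bilin)).
split=> [x y|x y|c]; first exact: funD.
- have funZ a (u : talg) : pair_fun (a *: u) = scal X a * pair_fun u.
    exact: (linearZ_LR (tlift pair_bilin)).
  have mulZl a (u v : talg) : (a *: u) * v = a *: (u * v) by exact: talg_mulZl.
  have mulZr a (u v : talg) : u * (a *: v) = a *: (u * v) by exact: talg_mulZr.
  move: x; apply: tensor_ind => [a b||x x' IH IH'|c x IH].
  + move: y; apply: tensor_ind => [a' b'||y y' IH IH'|c y IH].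
    * rewrite [_ * _]apureM !pair_apure (rmorphM f) (rmorphM g).
      by rewrite mulrACA.
    * by rewrite mulr0 fun0 mulr0.
    * by rewrite mulrDr !funD mulrDr IH IH'.
    * by rewrite mulZr !funZ IH mulrCA.
  + by rewrite mul0r fun0 mul0r.
  + by rewrite mulrDl !funD mulrDl IH IH'.
  + by rewrite mulZl !funZ IH mulrA.
- by rewrite scal_prodl pair_apure comap_scal rmorph1 mulr1.
Qed.

Definition pair : X ~> prod := Aff pair_morphism.

Lemma pairE a b : pair (apure a b) = f a * g b.
Proof. exact: pair_apure. Qed.

Lemma pair_pi1 : pair ;; pi1 = f.
Proof. by apply: affP => a; rewrite /= pair_apure rmorph1 mulr1. Qed.

Lemma pair_pi2 : pair ;; pi2 = g.
Proof. by apply: affP => b; rewrite /= pair_apure rmorph1 mul1r. Qed.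

End Pairing.
End TensorAlgebra.

Arguments pi1 {R A B}.
Arguments pi2 {R A B}.
Notation "A ** B" := (prod A B) (at level 40, left associativity).

(* f × g *)
Definition amap (R : comPzRingType) (A B A' B' : calg R)
    (f : A ~> A') (g : B ~> B') : A ** B ~> A' ** B' :=
  pair (pi1 ;; f) (pi2 ;; g).

(******************************************************************************)
(* Pullbacks in Aff_R: the pullback of f : A ~> C and g : B ~> C is A ⊗_C B   *)
(******************************************************************************)

Section Pullback.
Context (R : comPzRingType) (A B C : calg R) (f : A ~> C) (g : B ~> C).

(* A as a C-algebra *)
Definition over (A' : calg R) (f' : A' ~> C) : calg C :=
  CAlg (comap f' : {rmorphism C -> A'}).

Definition restrict (E : calg C) : calg R :=
  CAlg (scal E \o scal C : {rmorphism R -> E}).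

Definition pb : calg R := restrict (over f ** over g).

Definition pb1 : pb ~> A.
Proof.
refine (@Aff R pb A (fun a => @apure C (over f) (over g) a 1) _).
have [hD hM hs] := comapP (@pi1 C (over f) (over g)).
split=> // a; rewrite /= -(comap_scal f).
exact: (hs (scal C a)).
Defined.

Definition pb2 : pb ~> B.
Proof.
refine (@Aff R pb B (fun b => @apure C (over f) (over g) 1 b) _).
have [hD hM hs] := comapP (@pi2 C (over f) (over g)).
split=> // a; rewrite /= -(comap_scal g).
exact: (hs (scal C a)).
Defined.

Lemma pb_comm : pb1 ;; f = pb2 ;; g.
Proof.
apply: affP => c.
by rewrite [LHS](esym (scal_prodl (over f) (over g) c)) [LHS]scal_prodr.
Qed.

Section PbPair.
Context (X : calg R) (u : X ~> A) (v : X ~> B) (uv : u ;; f = v ;; g).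

Fact pb_pair_left : @alg_morphism C (over f) (over (u ;; f)) u.
Proof. by have [uD uM us] := comapP u; split. Qed.

Fact pb_pair_right : @alg_morphism C (over g) (over (u ;; f)) v.
Proof.
have [vD vM vs] := comapP v; split=> // c.
exact: (esym (congr1 (fun h => comap h c) uv)).
Qed.

Let pb_pair_over : over (u ;; f) ~> over f ** over g :=
  pair (Aff pb_pair_left) (Aff pb_pair_right).

Fact pb_pair_morphism : @alg_morphism R pb X pb_pair_over.
Proof.
have [hD hM hs] := comapP pb_pair_over.
by split=> // a; rewrite -(comap_scal (u ;; f)) -[RHS]hs.
Qed.

Definition pb_pair : X ~> pb := Aff pb_pair_morphism.

Lemma pb_pair1 : pb_pair ;; pb1 = u.
Proof.
apply: affP => a.
apply: etrans (pair_apure (Aff pb_pair_left) (Aff pb_pair_right) a 1) _.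
by rewrite /= (rmorph1 v) mulr1.
Qed.

Lemma pb_pair2 : pb_pair ;; pb2 = v.
Proof.
apply: affP => b.
apply: etrans (pair_apure (Aff pb_pair_left) (Aff pb_pair_right) 1 b) _.
by rewrite /= (rmorph1 u) mul1r.
Qed.

End PbPair.

Lemma pb_ext (X : calg R) (u v : X ~> pb) :
  u ;; pb1 = v ;; pb1 -> u ;; pb2 = v ;; pb2 -> u = v.
Proof.
move=> e1 e2; pose X' := over (u ;; pb1 ;; f).
have [uD uM us] := comapP u; have [vD vM vs] := comapP v.
have u'P : @alg_morphism C (over f ** over g) X' u.
  by split=> // c; rewrite scal_prodl.
have v'P : @alg_morphism C (over f ** over g) X' v.
  by split=> // c; rewrite /X' e1 scal_prodl.
suff e : Aff u'P = Aff v'P.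
  by apply: affP => x; exact: (congr1 (fun h : X' ~> _ => comap h x) e).
apply: prod_ext; apply: affP => x.
  exact: (congr1 (fun h : X ~> A => comap h x) e1).
exact: (congr1 (fun h : X ~> B => comap h x) e2).
Qed.

End Pullback.

Arguments pb1 {R A B C f g}.
Arguments pb2 {R A B C f g}.

(******************************************************************************)
(* Commutative R-algebras presented by generators and relations               *)
(******************************************************************************)

Section Presentation.
Context (R : comPzRingType) (X : Type).

Inductive aterm : Type :=
| AGen of X
| AConst of R
| AAdd of aterm & aterm
| AMul of aterm & aterm.

Context (rel : aterm -> aterm -> Prop).

Inductive acong : aterm -> aterm -> Prop :=
| ac_rel t u : rel t u -> acong t u
| ac_refl t : acong t t
| ac_sym t u : acong t u -> acong u t
| ac_trans t u v : acong t u -> acong u v -> acong t v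
| ac_add t t' u u' : acong t t' -> acong u u' -> acong (AAdd t u) (AAdd t' u')
| ac_mul t t' u u' : acong t t' -> acong u u' -> acong (AMul t u) (AMul t' u')
| ac_addA t u v : acong (AAdd t (AAdd u v)) (AAdd (AAdd t u) v)
| ac_addC t u : acong (AAdd t u) (AAdd u t)
| ac_add0 t : acong (AAdd (AConst 0) t) t
| ac_addN t : acong (AAdd (AMul (AConst (-1)) t) t) (AConst 0)
| ac_mulA t u v : acong (AMul t (AMul u v)) (AMul (AMul t u) v)
| ac_mulC t u : acong (AMul t u) (AMul u t)
| ac_mul1 t : acong (AMul (AConst 1) t) t
| ac_mulDl t u v : acong (AMul (AAdd t u) v) (AAdd (AMul t v) (AMul u v))
| ac_constD a b : acong (AConst (a + b)) (AAdd (AConst a) (AConst b))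
| ac_constM a b : acong (AConst (a * b)) (AMul (AConst a) (AConst b)).

HB.instance Definition _ := gen_eqMixin aterm.
HB.instance Definition _ := gen_choiceMixin aterm.

Definition acongb : ssrbool.rel aterm := fun t u => `[< acong t u >].

Lemma acongb_refl : reflexive acongb.
Proof. by move=> t; apply/asboolP/ac_refl. Qed.
Lemma acongb_sym : symmetric acongb.
Proof. by move=> t u; apply/asboolP/asboolP => /ac_sym. Qed.
Lemma acongb_trans : transitive acongb.
Proof.
by move=> u t v /asboolP tu /asboolP uv; apply/asboolP/(ac_trans tu uv).
Qed.

Canonical acong_equiv := EquivRel acongb acongb_refl acongb_sym acongb_trans.

Definition pres_sort := {eq_quot acong_equiv}.

HB.instance Definition _ := Choice.on pres_sort.

Definition aclass (t : aterm) : pres_sort := \pi_({eq_quot acong_equiv}) t.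

Lemma aclassP t u : acong t u -> aclass t = aclass u.
Proof. by move=> tu; rewrite /aclass; apply/eqmodP/asboolP. Qed.

Lemma aclass_ind (P : pres_sort -> Prop) :
  (forall t, P (aclass t)) -> forall x, P x.
Proof. by move=> Pt x; rewrite -[x]reprK; exact: Pt. Qed.

Lemma repr_aclass t : acong (repr (aclass t)) t.
Proof. by apply/asboolP; apply/(eqmodP acong_equiv); exact: reprK. Qed.

Definition pres_add (x y : pres_sort) := aclass (AAdd (repr x) (repr y)).
Definition pres_mul (x y : pres_sort) := aclass (AMul (repr x) (repr y)).
Definition pres_const (a : R) := aclass (AConst a).

Lemma aclass_add t u : aclass (AAdd t u) = pres_add (aclass t) (aclass u).
Proof. by apply/aclassP/ac_add; apply/ac_sym/repr_aclass. Qed.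

Lemma aclass_mul t u : aclass (AMul t u) = pres_mul (aclass t) (aclass u).
Proof. by apply/aclassP/ac_mul; apply/ac_sym/repr_aclass. Qed.

Fact pres_addA : associative pres_add.
Proof.
move=> x y z; elim/aclass_ind: x => ?; elim/aclass_ind: y => ?.
by elim/aclass_ind: z => ?; rewrite -!aclass_add; exact/aclassP/ac_addA.
Qed.
Fact pres_addC : commutative pres_add.
Proof.
move=> x y; elim/aclass_ind: x => ?; elim/aclass_ind: y => ?.
by rewrite -!aclass_add; exact/aclassP/ac_addC.
Qed.
Fact pres_add0 : left_id (pres_const 0) pres_add.
Proof.
by move=> x; elim/aclass_ind: x => ?; rewrite -aclass_add; exact/aclassP/ac_add0.
Qed.
Fact pres_addN :
  left_inverse (pres_const 0) (pres_mul (pres_const (-1))) pres_add.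
Proof.
move=> x; elim/aclass_ind: x => ?; rewrite -aclass_mul -aclass_add.
exact/aclassP/ac_addN.
Qed.

HB.instance Definition _ :=
  GRing.isZmodule.Build pres_sort pres_addA pres_addC pres_add0 pres_addN.

Lemma aclassD t u : aclass (AAdd t u) = aclass t + aclass u.
Proof. exact: aclass_add. Qed.

Fact pres_mulA : associative pres_mul.
Proof.
move=> x y z; elim/aclass_ind: x => ?; elim/aclass_ind: y => ?.
by elim/aclass_ind: z => ?; rewrite -!aclass_mul; exact/aclassP/ac_mulA.
Qed.
Fact pres_mulC : commutative pres_mul.
Proof.
move=> x y; elim/aclass_ind: x => ?; elim/aclass_ind: y => ?.
by rewrite -!aclass_mul; exact/aclassP/ac_mulC.
Qed.
Fact pres_mul1 : left_id (pres_const 1) pres_mul.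
Proof.
by move=> x; elim/aclass_ind: x => ?; rewrite -aclass_mul; exact/aclassP/ac_mul1.
Qed.
Fact pres_mulDl : left_distributive pres_mul +%R.
Proof.
move=> x y z; elim/aclass_ind: x => ?; elim/aclass_ind: y => ?.
elim/aclass_ind: z => ?; rewrite -aclassD -!aclass_mul -aclassD.
exact/aclassP/ac_mulDl.
Qed.

HB.instance Definition _ := GRing.Zmodule_isComPzRing.Build pres_sort
  pres_mulA pres_mulC pres_mul1 pres_mulDl.

Lemma aclassM t u : aclass (AMul t u) = aclass t * aclass u.
Proof. exact: aclass_mul. Qed.

Fact pres_const_semi_additive : semi_additive pres_const.
Proof.
by split=> // a b; rewrite /pres_const -aclassD; exact/aclassP/ac_constD.
Qed.
Fact pres_const_monoid : monoid_morphism pres_const.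
Proof.
by split=> // a b; rewrite /pres_const -aclassM; exact/aclassP/ac_constM.
Qed.

HB.instance Definition _ :=
  GRing.isSemiAdditive.Build R pres_sort pres_const pres_const_semi_additive.
HB.instance Definition _ :=
  GRing.isMonoidMorphism.Build R pres_sort pres_const pres_const_monoid.

Definition pres : calg R := @CAlg R pres_sort pres_const.

Definition pgen (x : X) : pres := aclass (AGen x).

Section Lift.
Context (E : calg R) (v : X -> E).

Fixpoint aeval (t : aterm) : E :=
  match t with
  | AGen x => v x
  | AConst a => scal E a
  | AAdd t u => aeval t + aeval u
  | AMul t u => aeval t * aeval u
  end.

Context (vP : forall t u, rel t u -> aeval t = aeval u).

Lemma aeval_cong t u : acong t u -> aeval t = aeval u.
Proof.
elim=> //=.
- by move=> ? ? ? _ -> _ ->.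
- by move=> ? ? ? ? _ -> _ ->.
- by move=> ? ? ? ? _ -> _ ->.
- by move=> *; rewrite addrA.
- by move=> *; rewrite addrC.
- by move=> *; rewrite rmorph0 add0r.
- by move=> *; rewrite rmorphN rmorph1 mulN1r addNr rmorph0.
- by move=> *; rewrite mulrA.
- by move=> *; rewrite mulrC.
- by move=> *; rewrite rmorph1 mul1r.
- by move=> *; rewrite mulrDl.
- by move=> *; rewrite rmorphD.
- by move=> *; rewrite rmorphM.
Qed.

Definition plift_fun (x : pres) : E := aeval (repr (x : pres_sort)).

Lemma plift_class t : plift_fun (aclass t) = aeval t.
Proof. exact: aeval_cong (repr_aclass t). Qed.

Fact plift_morphism : @alg_morphism R pres E plift_fun.
Proof.
split=> [x y|x y|a]; last exact: plift_class.
  elim/aclass_ind: x => t; elim/aclass_ind: y => u.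
  by rewrite -aclassD !plift_class.
elim/aclass_ind: x => t; elim/aclass_ind: y => u.
by rewrite -aclassM !plift_class.
Qed.

Definition plift : E ~> pres := Aff plift_morphism.

Lemma plift_gen x : plift (pgen x) = v x.
Proof. exact: plift_class. Qed.

End Lift.

Lemma pres_rel t u : rel t u -> aclass t = aclass u.
Proof. by move=> tu; apply/aclassP/ac_rel. Qed.

Lemma pres_ext (E : calg R) (f g : E ~> pres) :
  (forall x, f (pgen x) = g (pgen x)) -> f = g.
Proof.
move=> fg; apply: affP => x.
have [fD fM fs] := comapP f; have [gD gM gs] := comapP g.
elim/aclass_ind: x; elim=> [x|a|t IHt u IHu|t IHt u IHu].
- exact: fg.
- exact: etrans (fs a) (esym (gs a)).
- by rewrite aclassD [LHS]fD [RHS]gD IHt IHu.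
- by rewrite aclassM [LHS]fM [RHS]gM IHt IHu.
Qed.

End Presentation.

Arguments AGen {R X}.
Arguments AConst {R X}.

(******************************************************************************)
(* Sym_R(M)                                                                   *)
(******************************************************************************)

Section Sym.
Context (R : comPzRingType) (M : lmodType R).

Inductive sym_rel : aterm R M -> aterm R M -> Prop :=
| sym_relD m n : sym_rel (AGen (m + n)) (AAdd (AGen m) (AGen n))
| sym_relZ a m : sym_rel (AGen (a *: m)) (AMul (AConst a) (AGen m)).

Definition Sym : calg R := pres sym_rel.

Fact sym_gen_linear : linear (pgen sym_rel : M -> amod Sym).
Proof.
move=> a m n; rewrite /pgen (pres_rel (sym_relD _ _)) aclassD.
by rewrite (pres_rel (sym_relZ _ _)) aclassM.
Qed.

Definition sym_gen : hom M (amod Sym) := mk_hom sym_gen_linear.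

Section SymLift.
Context (E : calg R) (f : hom M (amod E)).

Fact sym_lift_rel t u : sym_rel t u ->
  aeval (f : M -> E) t = aeval (f : M -> E) u.
Proof.
by case=> [m n|a m] /=; [exact: (linearD f) | exact: (linearZ_LR f)].
Qed.

Definition sym_lift : E ~> Sym := plift sym_lift_rel.

Lemma sym_liftE m : sym_lift (sym_gen m) = f m.
Proof. exact: plift_gen. Qed.

End SymLift.

Lemma sym_ext (E : calg R) (f g : E ~> Sym) :
  (forall m, f (sym_gen m) = g (sym_gen m)) -> f = g.
Proof. exact: pres_ext. Qed.

End Sym.

Arguments sym_gen {R M}.

(******************************************************************************)
(* The tangent algebra TA = Sym_A Ω_A, generated by the a and the da          *)
(******************************************************************************)

Section Tangent.
Context (R : comPzRingType) (A : calg R).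

(* inl a stands for a, and inr a for da *)
Local Notation gen a := (AGen (inl a : A + A)).
Local Notation dgen a := (AGen (inr a : A + A)).

Inductive tan_rel : aterm R (A + A) -> aterm R (A + A) -> Prop :=
| tan_relD a b : tan_rel (gen (a + b)) (AAdd (gen a) (gen b))
| tan_relM a b : tan_rel (gen (a * b)) (AMul (gen a) (gen b))
| tan_rels r : tan_rel (gen (scal A r)) (AConst r)
| tan_reldD a b : tan_rel (dgen (a + b)) (AAdd (dgen a) (dgen b))
| tan_reldZ r a : tan_rel (dgen (scal A r * a)) (AMul (AConst r) (dgen a))
| tan_reld1 : tan_rel (dgen 1) (AConst 0)
| tan_reldM a b : tan_rel (dgen (a * b))
    (AAdd (AMul (gen a) (dgen b)) (AMul (gen b) (dgen a))).

Definition T : calg R := pres tan_rel.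

Definition tan_base (a : A) : T := pgen tan_rel (inl a).
Definition tan_d (a : A) : T := pgen tan_rel (inr a).

End Tangent.

Section TangentTheory.
Context (R : comPzRingType).
Implicit Types A B E X : calg R.

Lemma tan_baseD A (a b : A) : tan_base (a + b) = tan_base a + tan_base b.
Proof. by rewrite /tan_base /pgen (pres_rel (tan_relD _ _)) aclassD. Qed.
Lemma tan_baseM A (a b : A) : tan_base (a * b) = tan_base a * tan_base b.
Proof. by rewrite /tan_base /pgen (pres_rel (tan_relM _ _)) aclassM. Qed.
Lemma tan_base_scal A r : tan_base (scal A r) = scal (T A) r.
Proof. exact: (pres_rel (tan_rels _ _)). Qed.
Lemma tan_dD A (a b : A) : tan_d (a + b) = tan_d a + tan_d b.
Proof. by rewrite /tan_d /pgen (pres_rel (tan_reldD _ _)) aclassD. Qed.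
Lemma tan_dZ A r (a : A) : tan_d (scal A r * a) = scal (T A) r * tan_d a.
Proof. by rewrite /tan_d /pgen (pres_rel (tan_reldZ _ _)) aclassM. Qed.
Lemma tan_dM A (a b : A) :
  tan_d (a * b) = tan_base a * tan_d b + tan_base b * tan_d a.
Proof. by rewrite /tan_d /pgen (pres_rel (tan_reldM _ _)) aclassD !aclassM. Qed.

(* D is an R-derivation along f. *)
Definition derivation E A (f : E ~> A) (D : A -> E) :=
  [/\ {morph D : a b / a + b},
      forall r a, D (scal A r * a) = scal E r * D a
    & forall a b, D (a * b) = f a * D b + f b * D a].

(* The morphism given by a |-> f a and da |-> D a. *)
Section TanLift.
Context E A (f : E ~> A) (D : A -> E) (DP : derivation f D).

Definition tan_val (x : A + A) : E :=
  match x with inl a => f a | inr a => D a end.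

Fact tan_lift_rel t u : tan_rel t u -> aeval tan_val t = aeval tan_val u.
Proof.
have [fD fM fs] := comapP f; have [DD DZ DM] := DP.
case=> //= {t u}; rewrite rmorph0.
by have := DM 1 1; rewrite mulr1 (rmorph1 f) !mul1r => /eqP; rewrite addrC -subr_eq subrr => /eqP.
Qed.

Definition tan_lift : E ~> T A := plift tan_lift_rel.

Lemma tan_lift_base a : tan_lift (tan_base a) = f a.
Proof. exact: plift_gen. Qed.
Lemma tan_lift_d a : tan_lift (tan_d a) = D a.
Proof. exact: plift_gen. Qed.

End TanLift.

Lemma tan_ext E A (f g : E ~> T A) :
  (forall a, f (tan_base a) = g (tan_base a)) ->
  (forall a, f (tan_d a) = g (tan_d a)) -> f = g.
Proof. by move=> fg dfg; apply: pres_ext => -[]. Qed.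

(* Dual numbers E[ε]: algebra maps TA -> E amount to algebra maps A -> E[ε]. *)
Section Dual.
Context E.

Record dual_sort : Type := Dual { re : E; im : E }.

HB.instance Definition _ := gen_eqMixin dual_sort.
HB.instance Definition _ := gen_choiceMixin dual_sort.

Definition dual_add x y := Dual (re x + re y) (im x + im y).
Definition dual_opp x := Dual (- re x) (- im x).
Definition dual_mul x y := Dual (re x * re y) (re x * im y + re y * im x).

Fact dual_addA : associative dual_add.
Proof. by move=> x y z; rewrite /dual_add /= !addrA. Qed.
Fact dual_addC : commutative dual_add.
Proof. by move=> x y; rewrite /dual_add addrC [im x + _]addrC. Qed.
Fact dual_add0 : left_id (Dual 0 0) dual_add.
Proof. by case=> x y; rewrite /dual_add /= !add0r. Qed.
Fact dual_addN : left_inverse (Dual 0 0) dual_opp dual_add.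
Proof. by move=> x; rewrite /dual_add /= !addNr. Qed.

HB.instance Definition _ :=
  GRing.isZmodule.Build dual_sort dual_addA dual_addC dual_add0 dual_addN.

Fact dual_mulA : associative dual_mul.
Proof.
move=> x y z; rewrite /dual_mul /= !mulrDr !mulrA addrA; congr Dual.
by congr (_ + _ + _); congr (_ * _); rewrite mulrC.
Qed.
Fact dual_mulC : commutative dual_mul.
Proof. by move=> x y; rewrite /dual_mul mulrC addrC. Qed.
Fact dual_mul1 : left_id (Dual 1 0) dual_mul.
Proof. by case=> x y; rewrite /dual_mul /= !mul1r mulr0 addr0. Qed.
Fact dual_mulDl : left_distributive dual_mul +%R.
Proof.
move=> x y z; rewrite [RHS]/(dual_add _ _) /dual_mul /dual_add /=.
by rewrite !mulrDl mulrDr addrACA.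
Qed.

HB.instance Definition _ := GRing.Zmodule_isComPzRing.Build dual_sort
  dual_mulA dual_mulC dual_mul1 dual_mulDl.

Definition dual_scal (a : R) := Dual (scal E a) 0.

Fact dual_scal_semi_additive : semi_additive dual_scal.
Proof.
split=> [|a b]; first by rewrite /dual_scal rmorph0.
by rewrite [RHS]/(dual_add _ _) /dual_add /= addr0 -rmorphD.
Qed.
Fact dual_scal_monoid : monoid_morphism dual_scal.
Proof.
split=> [|a b]; first by rewrite /dual_scal rmorph1.
by rewrite [RHS]/(dual_mul _ _) /dual_mul /= !mulr0 addr0 -rmorphM.
Qed.

HB.instance Definition _ :=
  GRing.isSemiAdditive.Build R dual_sort dual_scal dual_scal_semi_additive.
HB.instance Definition _ :=
  GRing.isMonoidMorphism.Build R dual_sort dual_scal dual_scal_monoid.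

Definition dual : calg R := @CAlg R dual_sort dual_scal.

End Dual.

(* a |-> f a + ε D a *)
Section ToDual.
Context E A (f : E ~> A) (D : A -> E) (DP : derivation f D).

Fact to_dual_morphism : @alg_morphism R A (dual E) (fun a => Dual (f a) (D a)).
Proof.
have [fD fM fs] := comapP f; have [DD DZ DM] := DP.
split=> [a b|a b|r]; rewrite ?fD ?DD ?fM ?DM //.
rewrite fs -[in X in D X](mulr1 (scal A r)) DZ.
suff -> : D 1 = 0 by rewrite mulr0.
by have := DM 1 1; rewrite mulr1 (rmorph1 f) !mul1r => /eqP; rewrite addrC -subr_eq subrr => /eqP.
Qed.

Definition to_dual : dual E ~> A := Aff to_dual_morphism.
End ToDual.

Section OfDual.
Context E A (h : dual E ~> A).

Fact of_dual_morphism : @alg_morphism R A E (fun a => re (h a)).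
Proof.
by have [hD hM hs] := comapP h; split=> [a b|a b|r]; rewrite ?hD ?hM ?hs.
Qed.

Fact of_dual_derivation : derivation (Aff of_dual_morphism) (fun a => im (h a)).
Proof.
have [hD hM hs] := comapP h; split=> [a b|r a|a b]; rewrite ?hD ?hM ?hs //=.
by rewrite mulr0 addr0.
Qed.

Definition of_dual : E ~> T A := tan_lift of_dual_derivation.

Lemma of_dual_base a : of_dual (tan_base a) = re (h a).
Proof. exact: tan_lift_base. Qed.
Lemma of_dual_d a : of_dual (tan_d a) = im (h a).
Proof. exact: tan_lift_d. Qed.
End OfDual.

(* The structure maps of the tangent structure *)

Fact p_morphism A : @alg_morphism R A (T A) (@tan_base R A).
Proof. split=> [a b|a b|r]; [exact: tan_baseD|exact: tan_baseM|exact: tan_base_scal]. Qed.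

Definition pT {A} : T A ~> A := Aff (p_morphism A).

Fact z_derivation A : derivation (aff_id A) (fun=> 0).
Proof. by split=> [a b|r a|a b] /=; rewrite ?(mulr0, addr0). Qed.

Definition zT {A} : A ~> T A := tan_lift (z_derivation A).

Fact T_derivation A B (f : A ~> B) : derivation (pT ;; f) (fun b => tan_d (f b)).
Proof.
have [fD fM fs] := comapP f.
by split=> [a b|r a|a b]; rewrite ?fD ?fM ?fs ?tan_dD ?tan_dZ ?tan_dM.
Qed.

Definition Tm A B (f : A ~> B) : T A ~> T B := tan_lift (T_derivation f).

Definition T2 A : calg R := pb (@pT A) (@pT A).

Fact s_derivation A :
  derivation ((pb1 : T2 A ~> T A) ;; pT)
    (fun a => (pb1 : T2 A ~> T A) (tan_d a) + (pb2 : T2 A ~> T A) (tan_d a)).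
Proof.
have e (a : A) : (pb2 : T2 A ~> T A) (tan_base a) = (pb1 : T2 A ~> T A) (tan_base a).
  exact: (congr1 (fun h : T2 A ~> A => comap h a) (esym (pb_comm pT pT))).
have [D1 M1 s1] := comapP (pb1 : T2 A ~> T A).
have [D2 M2 s2] := comapP (pb2 : T2 A ~> T A).
split=> [a b|r a|a b].
- by rewrite tan_dD D1 D2 addrACA.
- by rewrite tan_dZ M1 M2 s1 s2 mulrDr.
- by rewrite tan_dM D1 D2 !M1 !M2 !e addrACA -!mulrDr.
Qed.

Definition sT {A} : T2 A ~> T A := tan_lift (s_derivation A).

Fact n_derivation A : derivation (@pT A) (fun a => - tan_d a).
Proof.
by split=> [a b|r a|a b]; rewrite ?tan_dD ?tan_dZ ?tan_dM ?opprD ?mulrN.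
Qed.

Definition nT {A} : T A ~> T A := tan_lift (n_derivation A).

(* lT : TTA -> TA is given by TA -> (TA)[ε], a |-> a, da |-> ε da. *)
Fact l_base_derivation A : derivation (@pT A) (fun=> 0).
Proof. by split=> [a b|r a|a b] /=; rewrite ?(mulr0, addr0). Qed.

Fact l_derivation A :
  derivation (to_dual (l_base_derivation A)) (fun a => Dual 0 (tan_d a)).
Proof.
split=> [a b|r a|a b].
- by rewrite tan_dD [RHS]/(dual_add _ _) /dual_add /= addr0.
- by rewrite tan_dZ [RHS]/(dual_mul _ _) /dual_mul /= !(mulr0, addr0).
- rewrite tan_dM [RHS]/(dual_add (dual_mul _ _) (dual_mul _ _)).
  by rewrite /dual_add /dual_mul /= !(mulr0, mul0r, addr0).
Qed.

Definition lT {A} : T A ~> T (T A) := of_dual (tan_lift (l_derivation A)).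

(* cT : TTA -> TTA is given by TA -> (TTA)[ε], a |-> a + ε da,                 *)
(* da |-> d'a + ε d'da, where d' denotes tan_d on TA.                         *)
Fact c_base_derivation A :
  derivation (@pT (T A) ;; pT) (fun a : A => tan_base (tan_d a)).
Proof.
split=> [a b|r a|a b] /=.
- by rewrite tan_dD tan_baseD.
- by rewrite tan_dZ tan_baseM tan_base_scal.
- by rewrite tan_dM tan_baseD !tan_baseM.
Qed.

Fact c_derivation A :
  derivation (to_dual (c_base_derivation A))
    (fun a : A => Dual (tan_d (tan_base a)) (tan_d (tan_d a))).
Proof.
split=> [a b|r a|a b].
- by rewrite tan_baseD !tan_dD.
- rewrite tan_baseM tan_base_scal !tan_dZ.
  by rewrite [RHS]/(dual_mul _ _) /dual_mul /= mulr0 addr0.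
- rewrite tan_baseM !tan_dM tan_dD !tan_dM.
  rewrite [RHS]/(dual_add (dual_mul _ _) (dual_mul _ _)).
  rewrite /dual_add /dual_mul /=; congr Dual.
  rewrite [tan_base (tan_d b) * _]mulrC [tan_base (tan_d a) * _]mulrC.
  rewrite addrACA [RHS]addrACA; congr (_ + _).
  exact: addrC.
Qed.

Definition cT {A} : T (T A) ~> T (T A) := of_dual (tan_lift (c_derivation A)).

(* ⟨f, g⟩ : X ~> TA × TB ≅ T(A × B) *)
Fact T_pair_derivation X A (f : X ~> T A) :
  derivation (f ;; pT) (fun a => f (tan_d a)).
Proof.
have [fD fM fs] := comapP f.
by split=> [a b|r a|a b]; rewrite ?tan_dD ?tan_dZ ?tan_dM ?fD ?fM ?fs.
Qed.

Definition Tpair X A B (f : X ~> T A) (g : X ~> T B) : X ~> T (A ** B) :=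
  of_dual (pair (to_dual (T_pair_derivation f)) (to_dual (T_pair_derivation g))).

Lemma pTE A (a : A) : pT a = tan_base a. Proof. by []. Qed.
Lemma zT_base A (a : A) : zT (tan_base a) = a.
Proof. exact: tan_lift_base. Qed.
Lemma zT_d A (a : A) : zT (tan_d a) = 0.
Proof. exact: tan_lift_d. Qed.
Lemma Tm_base A B (f : A ~> B) b : Tm f (tan_base b) = tan_base (f b).
Proof. exact: tan_lift_base. Qed.
Lemma Tm_d A B (f : A ~> B) b : Tm f (tan_d b) = tan_d (f b).
Proof. exact: tan_lift_d. Qed.
Lemma sT_base A (a : A) : sT (tan_base a) = apure (tan_base a : over pT) 1.
Proof. exact: tan_lift_base. Qed.
Lemma sT_d A (a : A) :
  sT (tan_d a) = apure (tan_d a : over pT) 1 + apure 1 (tan_d a : over pT).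
Proof. exact: tan_lift_d. Qed.
Lemma nT_base A (a : A) : nT (tan_base a) = tan_base a.
Proof. exact: tan_lift_base. Qed.
Lemma nT_d A (a : A) : nT (tan_d a) = - tan_d a.
Proof. exact: tan_lift_d. Qed.
Lemma lT_base A (a : A) : lT (tan_base (tan_base a)) = tan_base a.
Proof. by rewrite of_dual_base tan_lift_base. Qed.
Lemma lT_base_d A (a : A) : lT (tan_base (tan_d a)) = 0.
Proof. by rewrite of_dual_base tan_lift_d. Qed.
Lemma lT_d_base A (a : A) : lT (tan_d (tan_base a)) = 0.
Proof. by rewrite of_dual_d tan_lift_base. Qed.
Lemma lT_d_d A (a : A) : lT (tan_d (tan_d a)) = tan_d a.
Proof. by rewrite of_dual_d tan_lift_d. Qed.
Lemma cT_base A (a : A) :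
  cT (tan_base (tan_base a)) = tan_base (tan_base a).
Proof. by rewrite of_dual_base tan_lift_base. Qed.
Lemma cT_base_d A (a : A) : cT (tan_base (tan_d a)) = tan_d (tan_base a).
Proof. by rewrite of_dual_base tan_lift_d. Qed.
Lemma cT_d_base A (a : A) : cT (tan_d (tan_base a)) = tan_base (tan_d a).
Proof. by rewrite of_dual_d tan_lift_base. Qed.
Lemma cT_d_d A (a : A) : cT (tan_d (tan_d a)) = tan_d (tan_d a).
Proof. by rewrite of_dual_d tan_lift_d. Qed.

Lemma aff_compE A B E (f : A ~> B) (g : B ~> E) x : (f ;; g) x = f (g x).
Proof. by []. Qed.

Lemma aff_compA A B C D (f : A ~> B) (g : B ~> C) (h : C ~> D) :
  f ;; (g ;; h) = f ;; g ;; h.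
Proof. exact: affP. Qed.

Lemma Tpair1 X A B (f : X ~> T A) (g : X ~> T B) : Tpair f g ;; Tm pi1 = f.
Proof.
apply: tan_ext => a; rewrite aff_compE.
  rewrite Tm_base of_dual_base [pi1 a]/(apure a 1) pairE.
  by rewrite (rmorph1 (to_dual _)) mulr1.
rewrite Tm_d of_dual_d [pi1 a]/(apure a 1) pairE.
by rewrite (rmorph1 (to_dual _)) mulr1.
Qed.

Lemma Tpair2 X A B (f : X ~> T A) (g : X ~> T B) : Tpair f g ;; Tm pi2 = g.
Proof.
apply: tan_ext => a; rewrite aff_compE.
  rewrite Tm_base of_dual_base [pi2 a]/(apure 1 a) pairE.
  by rewrite (rmorph1 (to_dual _)) mul1r.
rewrite Tm_d of_dual_d [pi2 a]/(apure 1 a) pairE.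
by rewrite (rmorph1 (to_dual _)) mul1r.
Qed.

Lemma to_dualK X A (f : X ~> T A) : of_dual (to_dual (T_pair_derivation f)) = f.
Proof. by apply: tan_ext => a; rewrite ?of_dual_base ?of_dual_d. Qed.

Lemma of_dualK X A (h : dual X ~> A) :
  to_dual (T_pair_derivation (of_dual h)) = h.
Proof.
apply: affP => a; transitivity (Dual (re (h a)) (im (h a))).
  by congr Dual; [exact: of_dual_base | exact: of_dual_d].
by case: (h a).
Qed.

Lemma to_dual_comp X A B (f : X ~> T A) (h : A ~> B) :
  to_dual (T_pair_derivation (f ;; Tm h)) = to_dual (T_pair_derivation f) ;; h.
Proof.
apply: affP => b; congr Dual.
  by rewrite !aff_compE [f (Tm h _)](congr1 f (Tm_base h b)).
by rewrite /= [f _](congr1 f (Tm_d h b)).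
Qed.

Lemma Tprod_ext X A B (f g : X ~> T (A ** B)) :
  f ;; Tm pi1 = g ;; Tm pi1 -> f ;; Tm pi2 = g ;; Tm pi2 -> f = g.
Proof.
move=> e1 e2; rewrite -[f]to_dualK -[g]to_dualK; congr of_dual.
by apply: prod_ext; rewrite -!to_dual_comp ?e1 ?e2.
Qed.

(* ⟨f, g⟩ : X ~> TA ×_TC TB ≅ T(A ×_C B) *)
Section TPullback.
Context X A B C (h : A ~> C) (k : B ~> C) (f : X ~> T A) (g : X ~> T B).
Context (fg : f ;; Tm h = g ;; Tm k).

Fact Tpb_comm : to_dual (T_pair_derivation f) ;; h
              = to_dual (T_pair_derivation g) ;; k.
Proof. by rewrite -!to_dual_comp fg. Qed.

Definition Tpb_pair : X ~> T (pb h k) := of_dual (pb_pair Tpb_comm).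

Lemma Tpb_pair1 : Tpb_pair ;; Tm pb1 = f.
Proof.
rewrite -[LHS]to_dualK -[RHS]to_dualK to_dual_comp of_dualK.
by congr of_dual; exact: pb_pair1.
Qed.

Lemma Tpb_pair2 : Tpb_pair ;; Tm pb2 = g.
Proof.
rewrite -[LHS]to_dualK -[RHS]to_dualK to_dual_comp of_dualK.
by congr of_dual; exact: pb_pair2.
Qed.

End TPullback.

End TangentTheory.

Arguments pT {R A}.
Arguments zT {R A}.
Arguments sT {R A}.
Arguments nT {R A}.
Arguments lT {R A}.
Arguments cT {R A}.

(******************************************************************************)
(* Differential objects                                                       *)
(******************************************************************************)

Definition aff_iso (R : comPzRingType) (A B : calg R) (f : A ~> B) :=
  exists g : B ~> A, f ;; g = aff_id A /\ g ;; f = aff_id B.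

(* In dadd_assoc, (pi1 ;; pi1, pi1 ;; pi2, pi2) are the three projections     *)
(* of (A ** A) ** A.                                                          *)
Record diff_obj (R : comPzRingType) (A : calg R) := DiffObj {
  dzero : aff1 R ~> A;
  dadd : A ** A ~> A;
  dproj : T A ~> A;
  dadd_assoc :
    amap dadd (aff_id A) ;; dadd =
    pair (pi1 ;; pi1) (pair (pi1 ;; pi2) pi2 ;; dadd) ;; dadd;
  dadd_comm : pair pi2 pi1 ;; dadd = dadd;
  dadd_unit : pair (aff_to1 A ;; dzero) (aff_id A) ;; dadd = aff_id A;
  zT_dproj : zT ;; dproj = aff_to1 A ;; dzero;
  sT_dproj : sT ;; dproj = pair (pb1 ;; dproj) (pb2 ;; dproj) ;; dadd;
  Tdzero_dproj : Tm dzero ;; dproj = aff_to1 (T (aff1 R)) ;; dzero;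
  Tdadd_dproj :
    Tm dadd ;; dproj = pair (Tm pi1 ;; dproj) (Tm pi2 ;; dproj) ;; dadd;
  lT_dproj : lT ;; Tm dproj ;; dproj = dproj;
  dproj_iso : aff_iso (pair pT dproj)
}.

Definition diff_linear (R : comPzRingType) (A B : calg R)
    (dA : diff_obj A) (dB : diff_obj B) (f : A ~> B) :=
  Tm f ;; dproj dB = dproj dA ;; f.

(******************************************************************************)
(* The differential object Sym_R(M)                                           *)
(******************************************************************************)

Section PairTheory.
Context (R : comPzRingType) (A B X : calg R) (f : X ~> A) (g : X ~> B).

Lemma pair1E a : pair f g (pi1 a) = f a.
Proof. exact: (congr1 (fun h : X ~> A => h a) (pair_pi1 f g)). Qed.

Lemma pair2E b : pair f g (pi2 b) = g b.
Proof. exact: (congr1 (fun h : X ~> B => h b) (pair_pi2 f g)). Qed.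

End PairTheory.

Section AffElements.
Context (R : comPzRingType) (A B : calg R) (f : A ~> B).
Lemma comapD x y : f (x + y) = f x + f y. Proof. exact: rmorphD. Qed.
Lemma comapM x y : f (x * y) = f x * f y. Proof. exact: rmorphM. Qed.
Lemma comap0 : f 0 = 0. Proof. exact: rmorph0. Qed.
Lemma comap1 : f 1 = 1. Proof. exact: rmorph1. Qed.
End AffElements.

Section SymDiff.
Context (R : comPzRingType) (M : lmodType R).
Notation S := (Sym M).

Definition sym_zero : aff1 R ~> S := sym_lift (0 : hom M (amod (aff1 R))).

Fact sym_add_linear :
  linear (fun m => pi1 (sym_gen m : S) + pi2 (sym_gen m : S) : amod (S ** S)).
Proof.
move=> a m n; rewrite linearP !amodZ.
by rewrite !comapD !comapM !comap_scal mulrDr addrACA.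
Qed.

Definition sym_add : S ** S ~> S := sym_lift (mk_hom sym_add_linear).

Fact sym_proj_linear : linear (fun m => tan_d (sym_gen m : S) : amod (T S)).
Proof. by move=> a m n; rewrite linearP !amodZ tan_dD tan_dZ. Qed.

Definition sym_proj : T S ~> S := sym_lift (mk_hom sym_proj_linear).

Lemma sym_zeroE m : sym_zero (sym_gen m) = 0.
Proof. by rewrite sym_liftE. Qed.
Lemma sym_addE m : sym_add (sym_gen m) = pi1 (sym_gen m : S) + pi2 (sym_gen m : S).
Proof. by rewrite sym_liftE. Qed.
Lemma sym_projE m : sym_proj (sym_gen m) = tan_d (sym_gen m : S).
Proof. by rewrite sym_liftE. Qed.

Let symE := (aff_compE, sym_zeroE, sym_addE, sym_projE, comapD, comap0, pair1E, pair2E).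

Fact sym_addA : amap sym_add (aff_id S) ;; sym_add =
  pair (pi1 ;; pi1) (pair (pi1 ;; pi2) pi2 ;; sym_add) ;; sym_add.
Proof. by apply: sym_ext => m; rewrite !symE addrA. Qed.

Fact sym_addC : pair pi2 pi1 ;; sym_add = sym_add.
Proof. by apply: sym_ext => m; rewrite !symE addrC. Qed.

Fact sym_add0 : pair (aff_to1 S ;; sym_zero) (aff_id S) ;; sym_add = aff_id S.
Proof. by apply: sym_ext => m; rewrite !symE add0r. Qed.

Fact sym_zT : zT ;; sym_proj = aff_to1 S ;; sym_zero.
Proof. by apply: sym_ext => m; rewrite !symE zT_d. Qed.

Fact sym_sT : sT ;; sym_proj =
  pair (pb1 ;; sym_proj) (pb2 ;; sym_proj) ;; sym_add.
Proof. by apply: sym_ext => m; rewrite !symE sT_d. Qed.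

Fact sym_T0 : Tm sym_zero ;; sym_proj = aff_to1 (T (aff1 R)) ;; sym_zero.
Proof.
apply: sym_ext => m; rewrite !symE Tm_d sym_zeroE.
by have := tan_dZ (0 : R) (0 : aff1 R); rewrite mulr0 rmorph0 mul0r.
Qed.

Fact sym_TD : Tm sym_add ;; sym_proj =
  pair (Tm pi1 ;; sym_proj) (Tm pi2 ;; sym_proj) ;; sym_add.
Proof. by apply: sym_ext => m; rewrite !symE !Tm_d sym_addE tan_dD. Qed.

Fact sym_lT : lT ;; Tm sym_proj ;; sym_proj = sym_proj.
Proof. by apply: sym_ext => m; rewrite !symE Tm_d sym_projE lT_d_d. Qed.

Fact sym_iso : aff_iso (pair pT sym_proj).
Proof.
have L : linear (fun m => Dual (pi1 (sym_gen m : S)) (pi2 (sym_gen m : S))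
    : amod (dual (S ** S))).
  move=> a m n; rewrite linearP !amodZ !comapD !comapM !comap_scal.
  by rewrite [RHS]/(dual_add (dual_mul _ _) _) /dual_add /= mulr0 addr0.
pose g : S ** S ~> T S := of_dual (sym_lift (mk_hom L)).
have gd m : g (tan_d (sym_gen m : S)) = pi2 (sym_gen m : S).
  by rewrite of_dual_d sym_liftE.
have gb m : g (tan_base (sym_gen m : S)) = pi1 (sym_gen m : S).
  by rewrite of_dual_base sym_liftE.
exists g; split.
  rewrite -[LHS]to_dualK -[RHS]to_dualK; congr of_dual; apply: sym_ext => m.
  congr Dual; rewrite aff_compE ?gb ?gd ?pair1E ?pair2E ?sym_projE.
    by rewrite aff_compE pTE gb pair1E.
  exact: erefl.
apply: prod_ext; apply: sym_ext => m; rewrite !aff_compE.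
  by rewrite pair1E gb.
by rewrite pair2E sym_projE gd.
Qed.

Definition sym_diff : diff_obj S :=
  DiffObj sym_addA sym_addC sym_add0 sym_zT sym_sT sym_T0 sym_TD sym_lT sym_iso.

(* The bracket Sym(M) × Sym(M) ~> Sym(M) induced by γ : M -> M ⊗ M            *)
Fact sym_bracket_linear (gamma : hom M (tensor M M)) :
  linear (fun m => tmap sym_gen sym_gen (gamma m) : amod (S ** S)).
Proof.
move=> a m n; rewrite !linearP amodZ; congr (_ + _); exact: talg_scaleE.
Qed.

Definition sym_bracket (gamma : hom M (tensor M M)) : S ** S ~> S :=
  sym_lift (mk_hom (sym_bracket_linear gamma)).

End SymDiff.

(******************************************************************************)
(* Lie algebras and coLie algebras                                            *)
(******************************************************************************)

Record lieAlg (R : comPzRingType) := LieAlg {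
  lie_sort :> lmodType R;
  lie : lie_sort -> lie_sort -> lie_sort;
  lie_bilin : bilin lie;
  lie_alt : forall x, lie x x = 0;
  lie_jacobi : forall x y w,
    lie x (lie y w) + lie y (lie w x) + lie w (lie x y) = 0
}.

Definition lie_isomorphic (R : comPzRingType) (L L' : lieAlg R) :=
  exists f : hom L L', bijective f /\ forall x y, f (lie x y) = lie (f x) (f y).

Section TensorSymmetries.
Context (R : comPzRingType) (M : lmodType R).

Definition tswap : hom (tensor M M) (tensor M M).
Proof.
refine (@tlift R M M _ (fun x y => tpure y x) _).
by split=> ? a u v; [exact: tpure_linearr | exact: tpure_linearl].
Defined.

Lemma tswapE x y : tswap (tpure x y) = tpure y x.
Proof. exact: tliftE. Qed.

(* x ⊗ (y ⊗ z) |-> y ⊗ (z ⊗ x) *)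
Definition tcycle1 (x : M) : hom (tensor M M) (tensor M (tensor M M)).
Proof.
refine (@tlift R M M _ (fun y w => tpure y (tpure w x)) _).
by split=> ? a u v; rewrite ?tpure_linearl ?tpure_linearr.
Defined.

Lemma tcycle1E x y w : tcycle1 x (tpure y w) = tpure y (tpure w x).
Proof. exact: tliftE. Qed.

Definition tcycle : hom (tensor M (tensor M M)) (tensor M (tensor M M)).
Proof.
refine (@tlift R M (tensor M M) _ (fun x t => tcycle1 x t) _).
split=> [t a x y|x a t u]; last exact: linearP.
have -> : tcycle1 (a *: x + y) = a *: tcycle1 x + tcycle1 y; last by [].
apply: tensor_ext => u v.
by rewrite hom_addE hom_scaleE !tcycle1E !tpure_linearr.
Defined.

Lemma tcycleE x y w : tcycle (tpure x (tpure y w)) = tpure y (tpure w x).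
Proof. by rewrite tliftE tcycle1E. Qed.

End TensorSymmetries.

(* As R may have 2-torsion, antisymmetry is stated in the strong form         *)
(* im γ ⊆ im (1 - τ), dual to [x, x] = 0.                                     *)
Record coLie (R : comPzRingType) := CoLie {
  colie_sort :> lmodType R;
  cobr : hom colie_sort (tensor colie_sort colie_sort);
  cobr_alt : forall x, exists t, cobr x = t - tswap _ t;
  cobr_jacobi : forall x,
    let t := tmap (hom_id colie_sort) cobr (cobr x) in
    t + tcycle _ t + tcycle _ (tcycle _ t) = 0
}.

Section CoLieDual.
Context (R : comPzRingType).

(* α ⊗ β, with values in R ⊗ R = R *)
Definition tens_form (M N : lmodType R) (alpha : hom M R^o) (beta : hom N R^o) :
  hom (tensor M N) R^o.
Proof.
refine (@tlift R M N R^o (fun x y => alpha x * beta y) _).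
split=> ? a u v; rewrite linearP.
  by rewrite mulrDl [X in X + _](esym (mulrA _ _ _)).
by rewrite mulrDr; congr (_ + _); exact: mulrCA.
Defined.

Lemma tens_formE (M N : lmodType R) (alpha : hom M R^o) (beta : hom N R^o) x y :
  tens_form alpha beta (tpure x y) = alpha x * beta y.
Proof. exact: tliftE. Qed.

Context (C : coLie R).

Definition dual_lie (alpha beta : hom C R^o) : hom C R^o.
Proof.
refine (@mk_hom R C R^o (fun x => tens_form alpha beta (cobr C x)) _).
by move=> a x y; rewrite !linearP.
Defined.

Lemma dual_lieE alpha beta x :
  dual_lie alpha beta x = tens_form alpha beta (cobr C x).
Proof. by []. Qed.

Fact dual_lie_bilin : bilin dual_lie.
Proof.
split=> [beta|alpha] a f g; apply: homP => x; rewrite dual_lieE.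
  have -> : tens_form (a *: f + g) beta = a *: tens_form f beta + tens_form g beta.
    apply: tensor_ext => y w; rewrite !(hom_addE, hom_scaleE, tens_formE).
    by rewrite mulrDl [X in X + _](esym (mulrA _ _ _)).
  by [].
have -> : tens_form alpha (a *: f + g) = a *: tens_form alpha f + tens_form alpha g.
  apply: tensor_ext => y w; rewrite !(hom_addE, hom_scaleE, tens_formE).
  by rewrite mulrDr; congr (_ + _); exact: mulrCA.
by [].
Qed.

Fact dual_lie_alt alpha : dual_lie alpha alpha = 0.
Proof.
apply: homP => x; rewrite dual_lieE; have [t ->] := cobr_alt x.
rewrite homB; apply/eqP; rewrite subr_eq0; apply/eqP.
elim/tensor_ind: t => [y w||t u IHt IHu|a t IHt].
- by rewrite tswapE !tens_formE mulrC.
- by rewrite !hom0.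
- by rewrite !homD IHt IHu.
- by rewrite !homZ IHt.
Qed.

Fact dual_lie_jacobi alpha beta kappa :
  dual_lie alpha (dual_lie beta kappa) + dual_lie beta (dual_lie kappa alpha)
  + dual_lie kappa (dual_lie alpha beta) = 0.
Proof.
have form3 f g h x : dual_lie f (dual_lie g h) x =
    tens_form f (tens_form g h) (tmap (hom_id C) (cobr C) (cobr C x)).
  rewrite dual_lieE; elim/tensor_ind: (cobr C x) => [y w||t u IHt IHu|a t IHt].
  - by rewrite tmapE !tens_formE.
  - by rewrite !hom0.
  - by rewrite !homD IHt IHu.
  - by rewrite !homZ IHt.
have cyc f g h t : tens_form f (tens_form g h) (tcycle C t) =
    tens_form h (tens_form f g) t.
  elim/tensor_ind: t => [x s||t u IHt IHu|a t IHt].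
  - elim/tensor_ind: s => [y w||t u IHt IHu|a t IHt].
    + by rewrite tcycleE !tens_formE mulrA mulrC.
    + by rewrite tpure0r !hom0.
    + by rewrite tpureDr !homD IHt IHu.
    + by rewrite tpureZr !homZ IHt.
  - by rewrite !hom0.
  - by rewrite !homD IHt IHu.
  - by rewrite !homZ IHt.
apply: homP => x; rewrite !hom_addE !form3.
have /(congr1 (tens_form alpha (tens_form beta kappa))) := cobr_jacobi x.
by rewrite hom0 !homD !cyc addrAC => ->.
Qed.

Definition coLie_dual : lieAlg R :=
  LieAlg dual_lie_bilin dual_lie_alt dual_lie_jacobi.

End CoLieDual.

(******************************************************************************)
(* Group objects in Aff_R, i.e. commutative Hopf algebras: gone, gmul and     *)
(* ginv are the counit, the comultiplication Δ and the antipode.              *)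
(******************************************************************************)

Record aff_group (R : comPzRingType) := AffGroup {
  gcar :> calg R;
  gone : aff1 R ~> gcar;
  gmul : gcar ** gcar ~> gcar;
  ginv : gcar ~> gcar;
  gmul_assoc :
    amap gmul (aff_id gcar) ;; gmul =
    pair (pi1 ;; pi1) (pair (pi1 ;; pi2) pi2 ;; gmul) ;; gmul;
  gmul1l : pair (aff_to1 gcar ;; gone) (aff_id gcar) ;; gmul = aff_id gcar;
  gmul1r : pair (aff_id gcar) (aff_to1 gcar ;; gone) ;; gmul = aff_id gcar;
  gmulVl : pair ginv (aff_id gcar) ;; gmul = aff_to1 gcar ;; gone;
  gmulVr : pair (aff_id gcar) ginv ;; gmul = aff_to1 gcar ;; gone
}.

(******************************************************************************)
(* Left-invariant derivations                                                 *)
(******************************************************************************)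

Section LIDer.
Context (R : comPzRingType) (H : aff_group R).

Let HH := tensor (amod H) (amod H).
Let Delta (x : H) : HH := gmul H x.

Definition lider_pred : {pred hom (amod H) (amod H)} := fun delta => `[<
  (forall x y : H, delta (x * y : H) = x * (delta y : H) + y * (delta x : H)) /\
  (forall x : H, Delta (delta x) = tmap (hom_id (amod H)) delta (Delta x)) >].

Lemma DeltaP a (x y : amod H) : Delta (a *: x + y) = a *: Delta x + Delta y.
Proof.
rewrite amodZ /Delta comapD comapM comap_scal; congr (_ + _).
exact: esym (talg_scaleE _ _).
Qed.

Lemma tmap_linearr a (f g : hom (amod H) (amod H)) (t : HH) :
  tmap (hom_id (amod H)) (a *: f + g) t =
  a *: tmap (hom_id (amod H)) f t + tmap (hom_id (amod H)) g t.
Proof.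
elim/tensor_ind: t => [x y||t u IHt IHu|b t IHt].
- by rewrite !tmapE hom_addE hom_scaleE tpure_linearr.
- by rewrite !hom0 scaler0 addr0.
- by rewrite !homD IHt IHu scalerDr addrACA.
- by rewrite !homZ IHt scalerDr !scalerA mulrC.
Qed.

Lemma lider_submod_closed : submod_closed lider_pred.
Proof.
split=> [|a f g /asboolP[fM fD] /asboolP[gM gD]]; apply/asboolP; split.
- by move=> x y; rewrite !mulr0 addr0.
- move=> x; have := tmap_linearr 0 0 0 (Delta x).
  rewrite !scale0r !add0r => ->.
  have := DeltaP (-1) 0 0; rewrite !scaleN1r !addNr => ->.
  elim/tensor_ind: (Delta x) => [u v||t u IHt IHu|b t IHt].
  + by rewrite tmapE tpure0r.
  + by rewrite hom0.
  + by rewrite homD -IHt -IHu addr0.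
  + by rewrite homZ -IHt scaler0.
- move=> x y; rewrite !hom_addE !hom_scaleE fM gM !amodZ !mulrDr.
  by rewrite !(mulrCA (scal H a)) addrACA.
- move=> x; rewrite hom_addE hom_scaleE DeltaP fD gD.
  by rewrite tmap_linearr.
Qed.

HB.instance Definition _ := GRing.isSubmodClosed.Build R
  (hom (amod H) (amod H)) lider_pred lider_submod_closed.

Record LIDer := MkLIDer { lider :> hom (amod H) (amod H);
                          liderP : lider \in lider_pred }.

HB.instance Definition _ := [isSub for lider].
HB.instance Definition _ := [Choice of LIDer by <:].
HB.instance Definition _ := [SubChoice_isSubLmodule of LIDer by <:].

Lemma lider_ext (f g : LIDer) : (forall x, f x = g x) -> f = g.
Proof. by move=> fg; apply: val_inj; apply: homP. Qed.

Fact lider_comm_linear (f g : LIDer) :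
  linear (fun x => f (g x) - g (f x) : amod H).
Proof.
move=> a x y; rewrite !(homD, homZ) scalerBr opprD addrACA.
by rewrite -!addrA.
Qed.

Fact lider_comm_pred (f g : LIDer) :
  mk_hom (lider_comm_linear f g) \in lider_pred.
Proof.
have /asboolP[fM fD] := liderP f; have /asboolP[gM gD] := liderP g.
apply/asboolP; split=> [x y|x].
  have aux (u v w t u' w' : H) :
      (u + v + (w + t)) - (u' + t + (w' + v)) = (u - u') + (w - w').
    rewrite (addrACA u) (addrACA u') [t + v]addrC (opprD (u' + w')).
    by rewrite (addrACA (u + w)) subrr addr0 opprD addrACA.
  have fA (u v : H) : f (u + v : H) = (f u : H) + (f v : H) by exact: homD.
  have gA (u v : H) : g (u + v : H) = (g u : H) + (g v : H) by exact: homD.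
  rewrite [LHS]/(f (g (x * y : H)) - g (f (x * y : H)) : H).
  rewrite fM gM fA gA !fM !gM.
  rewrite (mulrC (f y : H)) (mulrC (f x : H)) !mulrBr.
  exact: aux.
set k := mk_hom _; have kE y : k y = f (g y) - g (f y) by [].
have -> : k x = -1 *: g (f x) + f (g x) by rewrite kE scaleN1r addrC.
rewrite DeltaP gD fD fD gD scaleN1r addrC.
elim/tensor_ind: (Delta x) => [u v||t u IHt IHu|b t IHt].
- by rewrite !tmapE kE tpureBr.
- by rewrite !hom0 subr0.
- by rewrite !homD -IHt -IHu opprD addrACA.
- by rewrite !homZ -IHt scalerBr.
Qed.

Definition lider_comm (f g : LIDer) : LIDer := MkLIDer (lider_comm_pred f g).

Lemma lider_commE f g x : lider_comm f g x = f (g x) - g (f x).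
Proof. by []. Qed.

Fact lider_comm_bilin : bilin lider_comm.
Proof.
split=> [g|f] a u v; apply: lider_ext => x.
  rewrite lider_commE [RHS](_ : _ = a *: lider_comm u g x + lider_comm v g x) //.
  rewrite !lider_commE [LHS](_ : _ = (a *: u (g x) + v (g x)) - g (a *: u x + v x)) //.
  by rewrite homD homZ scalerBr opprD addrACA.
rewrite lider_commE [RHS](_ : _ = a *: lider_comm f u x + lider_comm f v x) //.
rewrite !lider_commE [LHS](_ : _ = f (a *: u x + v x) - (a *: u (f x) + v (f x))) //.
by rewrite homD homZ scalerBr opprD addrACA.
Qed.

Fact lider_comm_alt f : lider_comm f f = 0.
Proof. by apply: lider_ext => x; rewrite lider_commE subrr. Qed.

Fact lider_comm_jacobi f g h :
  lider_comm f (lider_comm g h) + lider_comm g (lider_comm h f)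
  + lider_comm h (lider_comm f g) = 0.
Proof.
apply: lider_ext => x.
rewrite [LHS](_ : _ = lider_comm f (lider_comm g h) x
  + lider_comm g (lider_comm h f) x + lider_comm h (lider_comm f g) x) //.
rewrite [RHS](_ : _ = 0) // !lider_commE !homB.
have aux (u v w t u' v' : amod H) :
    u - v - (w - t) + (w - u' - (v' - v)) + (v' - t - (u - u')) = 0.
  have e (k1 k2 k3 k4 : amod H) : k1 - k2 - (k3 - k4) = (k1 + k4) - (k2 + k3).
    by rewrite !opprD opprK [- k3 + _]addrC addrACA.
  by rewrite !e (addrC w v) (addrC v' u') (addrC t u) !subrKA subrr.
exact: aux.
Qed.

Definition LIDer_lie : lieAlg R :=
  LieAlg lider_comm_bilin lider_comm_alt lider_comm_jacobi.

End LIDer.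

(******************************************************************************)
(* The internal Lie algebra of a group object                                 *)
(******************************************************************************)

Section InternalLie.
Context (R : comPzRingType) (G : aff_group R).

(* The tangent space at the unit, i.e. the pullback of pT along gone. *)
Definition Te : calg R := pb (pT : T G ~> G) (gone G).
Definition iota : Te ~> T G := pb1.

Definition omega : G ** Te ~> T G := Tpair (pi1 ;; zT) (pi2 ;; iota) ;; Tm (gmul G).

End InternalLie.

Section PLIVFBracket.
Context (R : comPzRingType).

(* d = f - g *)
Definition tan_sub (X A : calg R) (f g d : X ~> T A) : Prop :=
  exists fg : f ;; pT = (g ;; nT) ;; pT, d = pb_pair fg ;; sT.

(* u = {f} *)
Definition brace (X A : calg R) (f : X ~> T (T A)) (u : X ~> T A) : Prop :=
  exists fu : (f ;; pT ;; zT) ;; Tm pT = (u ;; lT) ;; Tm pT,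
    f = Tpb_pair fu ;; Tm sT.

(* Z = [X, Y], for A-PLIVFs X and Y *)
Definition plivf_bracket (G A : calg R) (X Y Z : G ** A ~> T G) : Prop :=
  exists d : G ** A ~> T (T G),
    tan_sub (Tpair X (pi2 ;; zT) ;; Tm Y) (Tpair Y (pi2 ;; zT) ;; Tm X ;; cT) d
    /\ brace d Z.

End PLIVFBracket.

Record internal_lie (R : comPzRingType) (G : aff_group R) := InternalLie {
  il_diff : diff_obj (Te G);
  il_lift : Te G ~> T (Te G);
  il_bracket : Te G ** Te G ~> Te G;
  il_zero_iota : dzero il_diff ;; iota G = gone G ;; zT;
  il_add_iota : exists e : (pi1 ;; iota G) ;; pT = (pi2 ;; iota G) ;; pT,
    dadd il_diff ;; iota G = pb_pair e ;; sT;
  il_lift_iota : il_lift ;; Tm (iota G) = iota G ;; lT;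
  (* il_lift is the vertical lift of il_diff *)
  il_lift_pT : il_lift ;; pT = aff_to1 (Te G) ;; dzero il_diff;
  il_lift_dproj : il_lift ;; dproj il_diff = aff_id (Te G);
  il_bracket_omega :
    plivf_bracket (amap (aff_id G) pi1 ;; omega G) (amap (aff_id G) pi2 ;; omega G)
      (amap (aff_id G) il_bracket ;; omega G)
}.

(* (A, br) corresponds to the coLie algebra C under Mod_R^op ≃ DO(Aff_R). *)
Definition corresponds_to (R : comPzRingType) (A : calg R) (dA : diff_obj A)
    (br : A ** A ~> A) (C : coLie R) : Prop :=
  exists phi : A ~> Sym C,
    [/\ aff_iso phi, diff_linear dA (sym_diff C) phi
      & br ;; phi = amap phi phi ;; sym_bracket (cobr C)].

(* Main.v *)
(* Let Te be the tangent space of H at the unit, and dbar a : Te the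
   restriction of da : TH to it. Algebra maps Te -> X are the same as
   derivations H -> X along the counit ε, so morphisms out of Te are determined
   by their values on the dbar a. One finds ω(da) = (id ⊗ dbar)(Δ a), and the
   bracket of two A-PLIVFs takes da to the commutator of the derivations of
   H ⊗ A that extend them. By coassociativity these compose by convolution, so
   the bracket of Te sends dbar a to (1 - τ)(dbar ⊗ dbar)(Δ a). The module
   corresponding to Te is the set of all dbar a, the degree one part of Te.

   Conversely, for any C corresponding to Te, an isomorphism Te ≅ Sym C of
   differential objects commutes with the vertical lifts, so it sends every
   dbar a into the image of C. Linear forms on C are therefore points of Te,
   i.e. ε-derivations D : H -> R, and D |-> (id ⊗ D) Δ identifies these with
   left-invariant derivations, convolution becoming composition. *)

Require Import Defs.
From HB Require Import structures.
From mathcomp Require Import all_boot ssralg ring.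
From mathcomp Require Import boolp.

Set Implicit Arguments.
Unset Strict Implicit.
Unset Printing Implicit Defensive.

Import GRing.Theory.
Local Open Scope ring_scope.

(* all_boot shadows Defs.iota by seq.iota. *)
Local Notation iota := Defs.iota.

(** * Associativity and contractions of tensor products *)

Section TensorMaps.
Context (R : comPzRingType).

Definition hom_comp (M N P : lmodType R) (g : hom N P) (f : hom M N) : hom M P.
Proof.
refine (@mk_hom R M P (fun x => g (f x)) _).
by move=> a x y; rewrite !linearP.
Defined.

Lemma tmap_comp (M N M' N' M'' N'' : lmodType R) (f : hom M M') (g : hom N N')
    (f' : hom M' M'') (g' : hom N' N'') t :
  tmap f' g' (tmap f g t) = tmap (hom_comp f' f) (hom_comp g' g) t.
Proof.
elim/tensor_ind: t => [x y||t u IHt IHu|a t IHt].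
- by rewrite !tmapE.
- by rewrite !hom0.
- by rewrite !homD IHt IHu.
- by rewrite !homZ IHt.
Qed.

Section Assoc.
Context (M N P : lmodType R).

Definition tassoc1 (p : P) : hom (tensor M N) (tensor M (tensor N P)).
Proof.
refine (@tlift R M N _ (fun m n => tpure m (tpure n p)) _).
by split=> ? a u v; rewrite ?tpure_linearl ?tpure_linearr.
Defined.

Definition tassoc : hom (tensor (tensor M N) P) (tensor M (tensor N P)).
Proof.
refine (@tlift R (tensor M N) P _ (fun t p => tassoc1 p t) _).
split=> [p a t u|t a p p']; first exact: linearP.
have -> : tassoc1 (a *: p + p') = a *: tassoc1 p + tassoc1 p'; last by [].
apply: tensor_ext => m n.
by rewrite hom_addE hom_scaleE !tliftE !tpure_linearr.
Defined.

Lemma tassocE m n p : tassoc (tpure (tpure m n) p) = tpure m (tpure n p).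
Proof. by rewrite !tliftE. Qed.

End Assoc.

(* f ⊗ id and id ⊗ f, followed by R ⊗ N = N and M ⊗ R = M *)
Definition tactl (M N : lmodType R) (f : hom M R^o) : hom (tensor M N) N.
Proof.
refine (@tlift R M N N (fun x n => (f x : R) *: n) _).
split=> [n a x y|x a n n']; first by rewrite linearP scalerDl scalerA.
by rewrite scalerDr !scalerA mulrC.
Defined.

Definition tactr (M N : lmodType R) (f : hom N R^o) : hom (tensor M N) M.
Proof.
refine (@tlift R M N M (fun x n => (f n : R) *: x) _).
split=> [n a x y|x a n n']; last by rewrite linearP scalerDl scalerA.
by rewrite scalerDr !scalerA mulrC.
Defined.

Lemma tactlE (M N : lmodType R) (f : hom M R^o) x (n : N) :
  tactl N f (tpure x n) = (f x : R) *: n.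
Proof. exact: tliftE. Qed.

Lemma tactrE (M N : lmodType R) (f : hom N R^o) (x : M) n :
  tactr M f (tpure x n) = (f n : R) *: x.
Proof. exact: tliftE. Qed.

End TensorMaps.

(* The R-modules amod (A ** B) and tensor (amod A) (amod B) have the same
   carrier, but their scaling operations agree only propositionally. *)
Section ProdModule.
Context (R : comPzRingType) (A B : calg R).

Definition of_prod : hom (amod (A ** B)) (tensor (amod A) (amod B)).
Proof.
refine (@mk_hom R (amod (A ** B)) (tensor (amod A) (amod B)) id _).
by move=> a x y; congr (_ + _); exact: esym (talg_scaleE _ _).
Defined.

Definition to_prod : hom (tensor (amod A) (amod B)) (amod (A ** B)).
Proof.
refine (@mk_hom R (tensor (amod A) (amod B)) (amod (A ** B)) id _).
by move=> a x y; congr (_ + _); exact: talg_scaleE.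
Defined.

Lemma prodZ (c : R) (t : tensor (amod A) (amod B)) :
  (c *: t : A ** B) = scal (A ** B) c * t.
Proof. exact: talg_scaleE. Qed.

Lemma comap_prodZ (X : calg R) (f : X ~> A ** B) (c : R)
    (t : tensor (amod A) (amod B)) :
  f (c *: t) = scal X c * f t.
Proof. by rewrite -(comap_scal f) -comapM; congr (f _); exact: prodZ. Qed.

End ProdModule.

(** * The group axioms as identities between linear maps on [H] *)

Section Hopf.
Context (R : comPzRingType) (H : aff_group R).

Notation M := (amod H).

Definition counit : hom M R^o.
Proof.
refine (@mk_hom R M R^o (gone H) _).
by move=> a x y; rewrite amodZ comapD comapM comap_scal.
Defined.

Definition comult : hom M (tensor M M) := mk_hom (@DeltaP R H).

Lemma comultE (a : H) : comult a = gmul H a.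
Proof. by []. Qed.

Lemma comult_counitl a : tactl M counit (comult a) = a.
Proof.
rewrite -[RHS]/(aff_id H a) -(gmul1l H) aff_compE -comultE.
elim/tensor_ind: (comult a) => [x y||t u IHt IHu|c t IHt].
- by rewrite tactlE; exact: esym (pairE (aff_to1 H ;; gone H) (aff_id H) x y).
- by rewrite hom0 comap0.
- by rewrite homD IHt IHu comapD.
- by rewrite homZ IHt comap_prodZ.
Qed.

Lemma comult_counitr a : tactr M counit (comult a) = a.
Proof.
rewrite -[RHS]/(aff_id H a) -(gmul1r H) aff_compE -comultE.
elim/tensor_ind: (comult a) => [x y||t u IHt IHu|c t IHt].
- rewrite tactrE; apply: esym.
  exact: etrans (pairE (aff_id H) (aff_to1 H ;; gone H) x y) (mulrC _ _).
- by rewrite hom0 comap0.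
- by rewrite homD IHt IHu comapD.
- by rewrite homZ IHt comap_prodZ.
Qed.

(** Both sides are images, under one linear map [k] that only regroups factors, of the two
    composites equated by [gmul_assoc]. *)
Lemma comult_coassoc a :
  tassoc M M M (tmap comult (hom_id M) (comult a)) =
  tmap (hom_id M) comult (comult a).
Proof.
pose k : hom (tensor (amod (H ** H)) M) (tensor M (tensor M M)) :=
  hom_comp (tassoc M M M) (tmap (of_prod H H) (hom_id M)).
have kE t p : k (tpure t p) = tassoc M M M (tpure (of_prod H H t) p).
  by rewrite [LHS](congr1 (tassoc M M M) (tmapE _ _ _ _)).
have e1 (t : tensor M M) : tassoc M M M (tmap comult (hom_id M) t) =
    k (amap (gmul H) (aff_id H) (t : H ** H)).
  elim/tensor_ind: t => [x y||t u IHt IHu|c t IHt].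
  - by rewrite tmapE [amap _ _ _]pairE -apureE kE.
  - by rewrite comap0 !hom0.
  - by rewrite comapD !homD IHt IHu.
  - by rewrite comap_prodZ -prodZ !homZ IHt.
have e2 (t : tensor M M) : tmap (hom_id M) comult t =
    k (pair (pi1 ;; pi1) (pair (pi1 ;; pi2) pi2 ;; gmul H) (t : H ** H)).
  elim/tensor_ind: t => [x y||t u IHt IHu|c t IHt].
  - rewrite tmapE [pair _ _ _]pairE [(_ ;; gmul H) _]aff_compE -comultE.
    elim/tensor_ind: (comult y) => [v w||t u IHt IHu|c t IHt].
    + rewrite [pair _ _ _]pairE !apureM !(mulr1, mul1r).
      by rewrite kE tassocE.
    + by rewrite comap0 mulr0 hom0 tpure0r.
    + by rewrite comapD mulrDr homD tpureDr IHt IHu.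
    + by rewrite tpureZr IHt comap_prodZ mulrCA -prodZ homZ.
  - by rewrite comap0 !hom0.
  - by rewrite comapD !homD IHt IHu.
  - by rewrite homZ IHt comap_prodZ -prodZ homZ.
rewrite e1 e2; congr (k _).
exact: (congr1 (fun h : _ ~> H => h a) (gmul_assoc H)).
Qed.

End Hopf.

Lemma aff_idE (R : comPzRingType) (A : calg R) (x : A) : aff_id A x = x.
Proof. by []. Qed.

Lemma tan_d_scal (R : comPzRingType) (A : calg R) (r : R) :
  tan_d (scal A r) = 0.
Proof.
rewrite -[scal A r]mulr1 tan_dZ; suff -> : tan_d (1 : A) = 0 by rewrite mulr0.
by rewrite [LHS](pres_rel (tan_reld1 A)); exact: (rmorph0 (scal (T A))).
Qed.

(** An algebra map from [T (T A)] to [E] is an algebra map from [T A] to [E[ε]], so two applications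
    of the universal property of [T] suffice. *)
Lemma TT_ext (R : comPzRingType) (E A : calg R) (f g : E ~> T (T A)) :
  (forall a, f (tan_base (tan_base a)) = g (tan_base (tan_base a))) ->
  (forall a, f (tan_base (tan_d a)) = g (tan_base (tan_d a))) ->
  (forall a, f (tan_d (tan_base a)) = g (tan_d (tan_base a))) ->
  (forall a, f (tan_d (tan_d a)) = g (tan_d (tan_d a))) -> f = g.
Proof.
move=> bb bd db dd; rewrite -[f]to_dualK -[g]to_dualK; congr of_dual.
by apply: tan_ext => a; congr Dual; rewrite ?aff_compE ?pTE.
Qed.

(** * The tangent space at the unit and its universal property *)

Section TangentSpace.
Context (R : comPzRingType) (H : aff_group R).

Notation Te := (Te H).
Notation eps := (gone H).

Lemma iota_base (a : H) : iota H (tan_base a) = scal Te (eps a).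
Proof.
rewrite -[RHS](comap_scal (pb2 : Te ~> aff1 R)).
exact: (congr1 (fun h : Te ~> H => h a) (pb_comm pT eps)).
Qed.

Fact dbar_linear : linear (fun a : amod H => iota H (tan_d (a : H)) : amod Te).
Proof. by move=> c x y; rewrite !amodZ tan_dD tan_dZ comapD comapM comap_scal. Qed.

Definition dbar : hom (amod H) (amod Te) := mk_hom dbar_linear.

Lemma iota_d (a : H) : iota H (tan_d a) = dbar a.
Proof. by []. Qed.

Definition unit_derivation (X : calg R) (D : H -> X) :=
  derivation (aff_to1 X ;; eps) D.

Lemma dbar_derivation : @unit_derivation Te dbar.
Proof.
split=> [x y|c x|x y]; first exact: (homD dbar x y).
  exact: (homZ dbar c x).
by rewrite -!iota_d tan_dM comapD !comapM !iota_base.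
Qed.

(** As an algebra [Te] is [TH ⊗_H R]; there the generators [tan_base a] become the scalars [ε a], so
    only the [dbar a] remain as generators. *)
Lemma Te_ind (P : Te -> Prop) :
    (forall a, P (dbar a)) -> (forall r, P (scal Te r)) ->
    (forall x y, P x -> P y -> P (x + y)) ->
    (forall x y, P x -> P y -> P (x * y)) ->
  forall x, P x.
Proof.
move=> Pd Ps PD PM.
have Pi t : P (iota H t).
  elim/aclass_ind: t; elim=> [[a|a]|r|t IHt u IHu|t IHt u IHu].
  - by rewrite -[aclass _ _]/(tan_base a) iota_base.
  - by rewrite -[aclass _ _]/(tan_d a) iota_d.
  - by rewrite -[aclass _ _]/(scal (T H) r) comap_scal.
  - by rewrite aclassD comapD; exact: PD.
  - by rewrite aclassM comapM; exact: PM.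
move=> x; elim/tensor_ind: x => [t r||x y Px Py|a x Px].
- have -> : tpure t r = iota H t * scal Te r; last exact: PM.
  rewrite -[scal Te r](comap_scal (pb2 : Te ~> aff1 R)).
  exact: (apureE (A := Defs.over (pT : T H ~> H)) (B := Defs.over eps) t r).
- by rewrite -[X in P X](rmorph0 (scal Te)); exact: Ps.
- exact: PD.
(* The tensor product is over [H], so here the scalar [a] is an element of [H] and acts through
   [tan_base]. *)
- have -> : a *: x = iota H (tan_base a) * (x : Te) :> Te; last exact: PM.
  rewrite [a *: x]talg_scaleE; congr (_ * (x : Te)).
  exact: (scal_prodl (Defs.over (pT : T H ~> H)) (Defs.over eps)).
Qed.

Lemma Te_ext (X : calg R) (f g : X ~> Te) :
  (forall a, f (dbar a) = g (dbar a)) -> f = g.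
Proof.
move=> fg; apply: affP; elim/Te_ind => [//|r|x y fx fy|x y fx fy].
- by rewrite !comap_scal.
- by rewrite !comapD fx fy.
- by rewrite !comapM fx fy.
Qed.

Section TeLift.
Context (X : calg R) (D : H -> X) (DP : unit_derivation D).

Fact Te_lift_comm : tan_lift DP ;; pT = aff_to1 X ;; eps.
Proof. by apply: affP => a; rewrite aff_compE pTE tan_lift_base. Qed.

Definition Te_lift : X ~> Te := pb_pair Te_lift_comm.

Lemma Te_liftE a : Te_lift (dbar a) = D a.
Proof.
rewrite -iota_d -[LHS]/((Te_lift ;; pb1) (tan_d a)) pb_pair1.
exact: tan_lift_d.
Qed.

End TeLift.

Lemma comp_unit_derivation (X : calg R) (f : X ~> Te) :
  unit_derivation (fun a => f (dbar a)).
Proof.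
have [dD dZ dM] := dbar_derivation; split=> [a b|r a|a b].
- by rewrite dD comapD.
- by rewrite dZ comapM comap_scal.
- by rewrite dM comapD !comapM !aff_compE !comap_scal.
Qed.

End TangentSpace.

(** * The differential object structure of the tangent space *)

Section TangentSpaceDiff.
Context (R : comPzRingType) (H : aff_group R).
Notation Te := (Te H).

Fact te_zero_derivation : unit_derivation (X := aff1 R) (fun _ : H => 0).
Proof. by split=> [a b|r a|a b]; rewrite !(mulr0, addr0). Qed.

Definition te_zero : aff1 R ~> Te := Te_lift te_zero_derivation.

Fact te_add_derivation :
  unit_derivation (X := Te ** Te) (fun a : H => pi1 (dbar H a : Te) + pi2 (dbar H a : Te)).
Proof.
have [dD dZ dM] := dbar_derivation H; split=> [a b|r a|a b].
- by rewrite dD !comapD addrACA.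
- by rewrite dZ !comapM !comap_scal mulrDr.
- by rewrite dM !comapD !comapM !aff_compE !comap_scal addrACA !mulrDr.
Qed.

Definition te_add : Te ** Te ~> Te := Te_lift te_add_derivation.

Fact te_proj_derivation :
  unit_derivation (X := T Te) (fun a : H => tan_d (dbar H a : Te)).
Proof.
have [dD dZ dM] := dbar_derivation H; split=> [a b|r a|a b].
- by rewrite dD tan_dD.
- by rewrite dZ tan_dZ.
- by rewrite dM tan_dD !tan_dZ.
Qed.

Definition te_proj : T Te ~> Te := Te_lift te_proj_derivation.

Fact te_lift_derivation :
  unit_derivation (X := dual Te) (fun a : H => Dual 0 (dbar H a : Te)).
Proof.
have [dD dZ dM] := dbar_derivation H.
by split=> [a b|r a|a b]; rewrite ?dD ?dZ ?dM;
  rewrite -?[RHS]/(dual_add (dual_mul _ _) (dual_mul _ _)) -?[RHS]/(dual_add _ _) -?[RHS]/(dual_mul _ _)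
          /dual_add /dual_mul /= ?(mulr0, mul0r, addr0).
Qed.

Definition te_lift : Te ~> T Te := of_dual (Te_lift te_lift_derivation).

Lemma te_zeroE a : te_zero (dbar H a) = 0. Proof. exact: Te_liftE. Qed.
Lemma te_addE a : te_add (dbar H a) = pi1 (dbar H a : Te) + pi2 (dbar H a : Te).
Proof. exact: Te_liftE. Qed.
Lemma te_projE a : te_proj (dbar H a) = tan_d (dbar H a : Te).
Proof. exact: Te_liftE. Qed.
Lemma te_lift_base a : te_lift (tan_base (dbar H a : Te)) = 0.
Proof. by rewrite of_dual_base Te_liftE. Qed.
Lemma te_lift_d a : te_lift (tan_d (dbar H a : Te)) = dbar H a.
Proof. by rewrite of_dual_d Te_liftE. Qed.

Let teE := (aff_compE, aff_idE, te_zeroE, te_addE, te_projE, comapD, comap0, pair1E, pair2E).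

Fact te_addA : amap te_add (aff_id Te) ;; te_add =
  pair (pi1 ;; pi1) (pair (pi1 ;; pi2) pi2 ;; te_add) ;; te_add.
Proof.
apply: Te_ext => a; rewrite [LHS]aff_compE [RHS]aff_compE te_addE /amap !comapD !pair1E !pair2E.
by rewrite !aff_compE aff_idE te_addE !comapD pair1E pair2E addrA.
Qed.

Fact te_addC : pair pi2 pi1 ;; te_add = te_add.
Proof. by apply: Te_ext => a; rewrite !teE addrC. Qed.

Fact te_add0 : pair (aff_to1 Te ;; te_zero) (aff_id Te) ;; te_add = aff_id Te.
Proof. by apply: Te_ext => a; rewrite !teE add0r. Qed.

Fact te_zT : zT ;; te_proj = aff_to1 Te ;; te_zero.
Proof. by apply: Te_ext => a; rewrite !teE zT_d. Qed.

Fact te_sT : sT ;; te_proj =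
  pair (pb1 ;; te_proj) (pb2 ;; te_proj) ;; te_add.
Proof. by apply: Te_ext => a; rewrite !teE sT_d. Qed.

Fact te_T0 : Tm te_zero ;; te_proj = aff_to1 (T (aff1 R)) ;; te_zero.
Proof.
apply: Te_ext => a; rewrite !teE Tm_d te_zeroE.
by have := tan_dZ (0 : R) (0 : aff1 R); rewrite mulr0 rmorph0 mul0r.
Qed.

Fact te_TD : Tm te_add ;; te_proj =
  pair (Tm pi1 ;; te_proj) (Tm pi2 ;; te_proj) ;; te_add.
Proof. by apply: Te_ext => a; rewrite !teE !Tm_d te_addE tan_dD. Qed.

Fact te_lT : lT ;; Tm te_proj ;; te_proj = te_proj.
Proof. by apply: Te_ext => a; rewrite !teE Tm_d te_projE lT_d_d. Qed.

Fact te_iso : aff_iso (pair pT te_proj).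
Proof.
have [dD dZ dM] := dbar_derivation H.
(* The inverse sends [dbar a] to its copy in the first factor and [tan_d (dbar a)] to its copy in
   the second; both are encoded in one derivation into dual numbers. *)
have DP : unit_derivation (X := dual (Te ** Te))
    (fun a => Dual (pi1 (dbar H a : Te)) (pi2 (dbar H a : Te))).
  split=> [a b|r a|a b].
  - by rewrite dD !comapD.
  - rewrite dZ !comapM !comap_scal.
    by rewrite [RHS]/(dual_mul _ _) /dual_mul /= mulr0 addr0.
  - rewrite dM !comapD !comapM !aff_compE !comap_scal.
    rewrite [RHS]/(dual_add (dual_mul _ _) (dual_mul _ _)).
    by rewrite /dual_add /dual_mul /= !mulr0 !addr0.
pose g : Te ** Te ~> T Te := of_dual (Te_lift DP).
have gd a : g (tan_d (dbar H a : Te)) = pi2 (dbar H a : Te).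
  by rewrite of_dual_d Te_liftE.
have gb a : g (tan_base (dbar H a : Te)) = pi1 (dbar H a : Te).
  by rewrite of_dual_base Te_liftE.
exists g; split.
  rewrite -[LHS]to_dualK -[RHS]to_dualK; congr of_dual; apply: Te_ext => a.
  congr Dual; rewrite aff_compE ?gb ?gd ?pair1E ?pair2E ?te_projE.
    by rewrite aff_compE pTE gb pair1E.
  exact: erefl.
apply: prod_ext; apply: Te_ext => a; rewrite !aff_compE.
  by rewrite pair1E gb aff_idE.
by rewrite pair2E te_projE gd aff_idE.
Qed.

Definition te_diff : diff_obj Te :=
  DiffObj te_addA te_addC te_add0 te_zT te_sT te_T0 te_TD te_lT te_iso.

Fact te_zero_iota : dzero te_diff ;; iota H = gone H ;; zT.
Proof.
apply: tan_ext => a; rewrite !aff_compE.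
  by rewrite iota_base zT_base comap_scal.
by rewrite iota_d te_zeroE zT_d comap0.
Qed.

Fact te_add_iota : exists e : (pi1 ;; iota H) ;; pT = (pi2 ;; iota H) ;; pT,
  dadd te_diff ;; iota H = pb_pair e ;; sT.
Proof.
have e : (pi1 ;; iota H) ;; pT = (pi2 ;; iota H) ;; pT.
  by apply: affP => a; rewrite !aff_compE pTE iota_base !comap_scal.
exists e.
have e1 t : pb_pair e (pb1 t) = pi1 (iota H t).
  exact: (congr1 (fun h : _ ~> T H => h t) (pb_pair1 e)).
have e2 t : pb_pair e (pb2 t) = pi2 (iota H t).
  exact: (congr1 (fun h : _ ~> T H => h t) (pb_pair2 e)).
apply: tan_ext => a; rewrite !aff_compE.
  by rewrite iota_base sT_base [RHS]e1 iota_base !comap_scal.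
by rewrite iota_d te_addE sT_d comapD [X in _ = X + _]e1 [X in _ = _ + X]e2 !iota_d.
Qed.

Fact te_lift_iota : te_lift ;; Tm (iota H) = iota H ;; lT.
Proof.
apply: TT_ext => a; rewrite !aff_compE ?Tm_base ?Tm_d ?iota_base ?iota_d.
- by rewrite lT_base iota_base tan_base_scal comap_scal.
- by rewrite lT_base_d comap0 te_lift_base.
- by rewrite lT_d_base comap0 tan_d_scal comap0.
- by rewrite lT_d_d te_lift_d.
Qed.

Fact te_lift_pT : te_lift ;; pT = aff_to1 Te ;; te_zero.
Proof.
by apply: Te_ext => a; rewrite !aff_compE pTE te_lift_base te_zeroE comap0.
Qed.

Fact te_lift_proj : te_lift ;; te_proj = aff_id Te.
Proof. by apply: Te_ext => a; rewrite !aff_compE te_projE te_lift_d. Qed.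

End TangentSpaceDiff.

(** * Subtraction and the brace, computed on generators *)

Section TangentOperations.
Context (R : comPzRingType) (X A : calg R).

(** Agreement on [tan_base] is exactly the compatibility needed for pairing into [T2 A]; negation
    fixes base elements, so the sign shows only on [tan_d]. *)
Lemma tan_subP (f g d : X ~> T A) : tan_sub f g d <->
  [/\ forall a, f (tan_base a) = g (tan_base a),
      forall a, d (tan_base a) = f (tan_base a)
    & forall a, d (tan_d a) = f (tan_d a) - g (tan_d a)].
Proof.
have valE (e : f ;; pT = (g ;; nT) ;; pT) a :
    (pb_pair e ;; sT) (tan_base a) = f (tan_base a) /\
    (pb_pair e ;; sT) (tan_d a) = f (tan_d a) - g (tan_d a).
  have e1 t : pb_pair e (pb1 t) = f t.
    exact: (congr1 (fun h : _ ~> T A => h t) (pb_pair1 e)).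
  have e2 t : pb_pair e (pb2 t) = g (nT t).
    exact: (congr1 (fun h : _ ~> T A => h t) (pb_pair2 e)).
  rewrite !aff_compE; split; first by rewrite sT_base [LHS]e1.
  rewrite sT_d comapD [X in X + _]e1 [X in _ + X]e2 nT_d.
  by rewrite -[- tan_d a]mulN1r -(rmorph1 (scal (T A))) -rmorphN comapM comap_scal
     rmorphN rmorph1 mulN1r.
split=> [[e ->]|[fg db dd]].
  split=> a; have [] := valE e a => // _ _.
  have := congr1 (fun h : _ ~> A => h a) e.
  by rewrite !aff_compE !pTE nT_base.
have e : f ;; pT = (g ;; nT) ;; pT.
  by apply: affP => a; rewrite !aff_compE !pTE nT_base fg.
by exists e; apply: tan_ext => a; have [vb vd] := valE e a; rewrite ?vb ?vd.
Qed.

(** The value at [tan_base (tan_d a)] is unconstrained: the component [f ;; pT ;; zT] carries it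
    along unchanged, while [lT] kills it in the other component. *)
Lemma braceP (f : X ~> T (T A)) (u : X ~> T A) : brace f u <->
  [/\ forall a, f (tan_base (tan_base a)) = u (tan_base a),
      forall a, f (tan_d (tan_base a)) = 0
    & forall a, f (tan_d (tan_d a)) = u (tan_d a)].
Proof.
have valE (e : (f ;; pT ;; zT) ;; Tm pT = (u ;; lT) ;; Tm pT) a :
    let r := Tpb_pair e ;; Tm sT in
    [/\ r (tan_base (tan_base a)) = f (tan_base (tan_base a)),
        r (tan_base (tan_d a)) = f (tan_base (tan_d a)),
        r (tan_d (tan_base a)) = 0
      & r (tan_d (tan_d a)) = u (tan_d a)].
  have e1 t : Tpb_pair e (Tm pb1 t) = f (tan_base (zT t)).
    exact: (congr1 (fun h : _ ~> T (T A) => h t) (Tpb_pair1 e)).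
  have e2 t : Tpb_pair e (Tm pb2 t) = u (lT t).
    exact: (congr1 (fun h : _ ~> T (T A) => h t) (Tpb_pair2 e)).
  have sb : sT (tan_base a) = pb1 (tan_base a) by exact: sT_base.
  have sd : sT (tan_d a) = pb1 (tan_d a) + pb2 (tan_d a) by exact: sT_d.
  have f0 : f (tan_base 0) = 0.
    by rewrite -(rmorph0 (scal (T A))) tan_base_scal comap_scal rmorph0.
  have e1b t : Tpb_pair e (tan_base (pb1 t)) = f (tan_base t).
    by rewrite -[in LHS]Tm_base e1 zT_base.
  have e1d t : Tpb_pair e (tan_d (pb1 t)) = 0.
    by rewrite -[in LHS]Tm_d e1 zT_d.
  have e2b t : Tpb_pair e (tan_base (pb2 t)) = u (lT (tan_base t)).
    by rewrite -[in LHS]Tm_base e2.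
  have e2d t : Tpb_pair e (tan_d (pb2 t)) = u (lT (tan_d t)).
    by rewrite -[in LHS]Tm_d e2.
  move=> r; rewrite {}/r !aff_compE !Tm_base !Tm_d sb sd tan_baseD tan_dD !comapD.
  by split; rewrite ?e1b ?e1d ?e2b ?e2d ?lT_base_d ?lT_d_d ?comap0 ?addr0 ?add0r.
split=> [[e ef]|[bb db dd]].
  split=> a; last 2 first.
  - by rewrite ef; have [] := valE e a.
  - by rewrite [in LHS]ef; have [] := valE e a.
  have := congr1 (fun h : _ ~> T A => h (tan_base a)) e.
  by rewrite !aff_compE !Tm_base zT_base !pTE lT_base.
have e : (f ;; pT ;; zT) ;; Tm pT = (u ;; lT) ;; Tm pT.
  apply: tan_ext => a; rewrite !aff_compE !(Tm_base, Tm_d) ?(zT_base, zT_d) !pTE.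
    by rewrite bb lT_base.
  rewrite lT_d_base comap0.
  by rewrite -(rmorph0 (scal (T A))) tan_base_scal comap_scal rmorph0.
by exists e; apply: TT_ext => a; have [] := valE e a => *; congruence.
Qed.

End TangentOperations.

(** * The bracket of vector fields as a commutator of derivations *)

Section PLIVF.
Context (R : comPzRingType) (G A : calg R).
Implicit Types X Y Z : G ** A ~> T G.

(* The derivation of G ⊗ A that extends X and vanishes on A. *)
Definition extend_plivf X (t : G ** A) : G ** A := Tpair X (pi2 ;; zT) (tan_d t).

Section Extend.
Context (X : G ** A ~> T G) (XP : forall a, X (tan_base a) = pi1 a).

Lemma Tpair_plivf_base t : Tpair X (pi2 ;; zT) (tan_base t) = t.
Proof.
suff /(congr1 (fun h : _ ~> _ => h t)) : Tpair X (pi2 ;; zT) ;; pT = aff_id (G ** A) by [].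
apply: prod_ext; apply: affP => a; rewrite !aff_compE pTE -Tm_base.
  by rewrite -XP; exact: (congr1 (fun h : _ ~> _ => h (tan_base a)) (Tpair1 X (pi2 ;; zT))).
rewrite [LHS](congr1 (fun h : _ ~> _ => h (tan_base a)) (Tpair2 X (pi2 ;; zT))).
by rewrite aff_compE zT_base.
Qed.

Lemma extend_plivf1 a : extend_plivf X (pi1 a) = X (tan_d a).
Proof.
rewrite /extend_plivf -Tm_d.
exact: (congr1 (fun h : _ ~> _ => h (tan_d a)) (Tpair1 X (pi2 ;; zT))).
Qed.

Lemma extend_plivf2 u : extend_plivf X (pi2 u) = 0.
Proof.
rewrite /extend_plivf -Tm_d.
rewrite [LHS](congr1 (fun h : _ ~> _ => h (tan_d u)) (Tpair2 X (pi2 ;; zT))).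
by rewrite aff_compE zT_d comap0.
Qed.

Lemma extend_plivfM s t :
  extend_plivf X (s * t) = s * extend_plivf X t + t * extend_plivf X s.
Proof. by rewrite /extend_plivf tan_dM comapD !comapM !Tpair_plivf_base. Qed.

Lemma extend_plivfD s t :
  extend_plivf X (s + t) = extend_plivf X s + extend_plivf X t.
Proof. by rewrite /extend_plivf tan_dD comapD. Qed.

Lemma extend_plivfZ r t :
  extend_plivf X (scal _ r * t) = scal _ r * extend_plivf X t.
Proof. by rewrite /extend_plivf tan_dZ comapM comap_scal. Qed.

Lemma extend_plivf_pure a u : extend_plivf X (pi1 a * pi2 u) = pi2 u * X (tan_d a).
Proof. by rewrite extend_plivfM extend_plivf2 mulr0 add0r extend_plivf1. Qed.

End Extend.

(** The flip [cT] makes the first-order values of the two composites agree, so their difference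
    exists and vanishes on [tan_d (tan_base a)]. What remains on [tan_d (tan_d a)] is the commutator
    of the extended derivations. *)
Lemma plivf_bracketP X Y Z :
    (forall a, X (tan_base a) = pi1 a) -> (forall a, Y (tan_base a) = pi1 a) ->
  plivf_bracket X Y Z <->
  [/\ forall a, Z (tan_base a) = pi1 a
    & forall a, Z (tan_d a) =
        extend_plivf X (Y (tan_d a)) - extend_plivf Y (X (tan_d a))].
Proof.
move=> XP YP; rewrite /plivf_bracket.
set f := Tpair X (pi2 ;; zT) ;; Tm Y.
set g := Tpair Y (pi2 ;; zT) ;; Tm X ;; cT.
have fbb a : f (tan_base (tan_base a)) = pi1 a.
  by rewrite aff_compE Tm_base Tpair_plivf_base.
have fbd a : f (tan_base (tan_d a)) = Y (tan_d a).
  by rewrite aff_compE Tm_base Tpair_plivf_base.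
have fdb a : f (tan_d (tan_base a)) = X (tan_d a).
  by rewrite aff_compE Tm_d YP [LHS]extend_plivf1.
have fdd a : f (tan_d (tan_d a)) = extend_plivf X (Y (tan_d a)).
  by rewrite aff_compE Tm_d.
have gbb a : g (tan_base (tan_base a)) = pi1 a.
  by rewrite !aff_compE cT_base Tm_base Tpair_plivf_base.
have gbd a : g (tan_base (tan_d a)) = Y (tan_d a).
  by rewrite !aff_compE cT_base_d Tm_d XP [LHS]extend_plivf1.
have gdb a : g (tan_d (tan_base a)) = X (tan_d a).
  by rewrite !aff_compE cT_d_base Tm_base Tpair_plivf_base.
have gdd a : g (tan_d (tan_d a)) = extend_plivf Y (X (tan_d a)).
  by rewrite !aff_compE cT_d_d Tm_d.
clearbody f g; split=> [[d [/tan_subP[_ db dd] /braceP[bb _ Zd]]]|[Zb Zd]].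
  split=> a; first by rewrite -bb db fbb.
  by rewrite -Zd dd fdd gdd.
have e : f ;; pT = (g ;; nT) ;; pT.
  apply: tan_ext => a; rewrite !aff_compE !pTE [nT _]nT_base.
    by rewrite fbb gbb.
  by rewrite fbd gbd.
exists (pb_pair e ;; sT).
have de : tan_sub f g (pb_pair e ;; sT) by exists e.
split=> //; have /tan_subP[_ db dd] := de; apply/braceP; split=> a.
- by rewrite db fbb Zb.
- by rewrite dd fdb gdb subrr.
- by rewrite dd fdd gdd Zd.
Qed.

End PLIVF.

(** * Convolution of linear maps from [H] to an algebra *)

Lemma tmapBr (R : comPzRingType) (M N N' : lmodType R) (f g : hom N N')
    (t : tensor M N) :
  tmap (hom_id M) (f - g) t = tmap (hom_id M) f t - tmap (hom_id M) g t.
Proof.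
elim/tensor_ind: t => [x y||t u IHt IHu|a t IHt].
- by rewrite !tmapE hom_addE hom_oppE tpureBr.
- by rewrite !hom0 subr0.
- by rewrite !homD IHt IHu opprD addrACA.
- by rewrite !homZ IHt scalerBr.
Qed.

Lemma tactl_tmap (R : comPzRingType) (M N N' : lmodType R) (e : hom M R^o)
    (f : hom N N') (t : tensor M N) :
  tactl N' e (tmap (hom_id M) f t) = f (tactl N e t).
Proof.
elim/tensor_ind: t => [x y||t u IHt IHu|a t IHt].
- by rewrite tmapE !tactlE homZ.
- by rewrite !hom0.
- by rewrite !homD IHt IHu.
- by rewrite !homZ IHt.
Qed.

Section Convolution.
Context (R : comPzRingType) (H : aff_group R) (A : calg R).
Implicit Types f g : hom (amod H) (amod A).

Definition mul_homs f g : hom (tensor (amod H) (amod H)) (amod A).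
Proof.
refine (@tlift R (amod H) (amod H) (amod A) (fun x y => (f x : A) * (g y : A)) _).
split=> [y c x x'|x c y y']; rewrite homD homZ !amodZ.
  by rewrite mulrDl mulrA.
by rewrite mulrDr mulrCA.
Defined.

Lemma mul_homsE f g x y : mul_homs f g (tpure x y) = (f x : A) * (g y : A).
Proof. exact: tliftE. Qed.

Definition conv f g : hom (amod H) (amod A) := hom_comp (mul_homs f g) (comult H).

Lemma convE f g a : conv f g a = mul_homs f g (comult H a).
Proof. by []. Qed.

End Convolution.

Lemma amap_tmap (R : comPzRingType) (A B A' B' : calg R) (f : A ~> A')
    (g : B ~> B') (t : tensor (amod A') (amod B')) :
  amap f g t = tmap (comap_hom f) (comap_hom g) t.
Proof.
elim/tensor_ind: t => [x y||t u IHt IHu|c t IHt].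
- by rewrite tmapE [LHS]pairE -apureE.
- by rewrite [LHS]comap0 hom0.
- by rewrite [LHS]comapD homD IHt IHu.
- by rewrite [LHS]comap_prodZ homZ IHt -prodZ.
Qed.

(** * Invariant fields, their bracket, and existence of the internal Lie algebra *)

Section LeftInvariant.
Context (R : comPzRingType) (H : aff_group R).
Notation M := (amod H).

Section Commutator.
Context (A : calg R).

(** The shape of a left-invariant field with value [f] at the unit; the formula [(id ⊗ f)Δ] replaces
    the invariance equation. *)
Definition inv_field (X : H ** A ~> T H) (f : hom M (amod A)) :=
  (forall a, X (tan_base a) = pi1 a) /\
  (forall a, X (tan_d a) = tmap (hom_id M) f (comult H a)).

(** Extending [X] over [x ⊗ g y] gives the sum of the [x1 ⊗ f x2 * g y], which involves [(Δ ⊗ id)Δ];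
    coassociativity turns it into [(id ⊗ Δ)Δ], where the last two factors form the convolution. *)
Lemma extend_inv_field X Y f g a : inv_field X f -> inv_field Y g ->
  extend_plivf X (Y (tan_d a)) = tmap (hom_id M) (conv f g) (comult H a).
Proof.
move=> [Xb Xd] [Yb Yd]; rewrite Yd.
rewrite -[RHS](tmap_comp (hom_id M) (comult H) (hom_id M) (mul_homs f g)).
rewrite -comult_coassoc.
elim/tensor_ind: (comult H a) => [x y||t u IHt IHu|c t IHt].
- rewrite !tmapE [tpure _ _]apureE extend_plivf_pure // Xd.
  elim/tensor_ind: (comult H x) => [v w||t u IHt IHu|c t IHt].
  + rewrite tassocE !tmapE mul_homsE.
    by rewrite [LHS](apureM (1 : H) _ v _) mul1r mulrC.
  + rewrite [tpure 0 _](_ : _ = 0) ?hom0 ?mulr0 //.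
    by have := tpureZl 0 (0 : tensor M M) y; rewrite !scale0r.
  + by rewrite tpureDl !homD mulrDr IHt IHu.
  + by rewrite tpureZl !homZ -IHt !prodZ mulrCA.
- rewrite !hom0 /extend_plivf -[0 in LHS](rmorph0 (scal (H ** A))).
  by rewrite tan_d_scal comap0.
- by rewrite !homD extend_plivfD IHt IHu.
- by rewrite !homZ [X in extend_plivf _ X]prodZ extend_plivfZ IHt prodZ.
Qed.

(** The counit on the first factor recovers [h] from [(id ⊗ h)Δ], so comparing fields amounts to
    comparing their values at the unit. *)
Lemma inv_field_bracket X Y Z f g h :
    inv_field X f -> inv_field Y g -> inv_field Z h ->
  plivf_bracket X Y Z <-> h = conv f g - conv g f.
Proof.
move=> Xf Yg [Zb Zd]; rewrite plivf_bracketP; [|exact: Xf.1|exact: Yg.1].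
split=> [[_ ZE]|hE].
  apply: homP => a; have := ZE a.
  rewrite Zd (extend_inv_field _ Xf Yg) (extend_inv_field _ Yg Xf).
  move=> /(congr1 (tactl (amod A) (counit H))).
  rewrite [in RHS]homB !tactl_tmap comult_counitl => ->.
  by rewrite hom_addE hom_oppE.
split=> // a.
by rewrite Zd hE (extend_inv_field _ Xf Yg) (extend_inv_field _ Yg Xf) tmapBr.
Qed.

Lemma inv_field_comm_derivation X Y f g : inv_field X f -> inv_field Y g ->
  @unit_derivation R H A (conv f g - conv g f).
Proof.
set k := conv f g - conv g f => Xf Yg.
split=> [a b|r a|a b]; first exact: (homD k a b).
  exact: (homZ k r a).
(* [q] restricts to the unit of the group. By [commE], [k] is the restriction of a commutator of two
   derivations, so the Leibniz cross terms cancel in the final [ring]. *)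
pose q : A ~> H ** A := pair (aff_to1 A ;; gone H) (aff_id A).
have qE (t : tensor M (amod A)) : q t = tactl (amod A) (counit H) t.
  elim/tensor_ind: t => [x y||t u IHt IHu|c t IHt].
  - by rewrite tactlE [LHS]pairE.
  - by rewrite [LHS]comap0 hom0.
  - by rewrite [LHS]comapD homD IHt IHu.
  - by rewrite [LHS]comap_prodZ homZ IHt.
have commE c : k c =
    q (extend_plivf X (Y (tan_d c))) - q (extend_plivf Y (X (tan_d c))).
  rewrite (extend_inv_field _ Xf Yg) (extend_inv_field _ Yg Xf) !qE.
  by rewrite !tactl_tmap comult_counitl.
have q1 c : q (pi1 c) = (aff_to1 A ;; gone H) c by exact: pair1E.
rewrite !commE !tan_dM !comapD !comapM !Xf.1 !Yg.1 !extend_plivfD.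
rewrite !(extend_plivfM Xf.1) !(extend_plivfM Yg.1) !extend_plivf1.
move: (extend_plivf X) (extend_plivf Y) => DX DY.
rewrite !(comapD q) !(comapM q) !q1.
ring.
Qed.

End Commutator.

(** [W] is the zero vector at a point of the group paired with a tangent vector at the unit.
    Differentials die in the first factor and base elements of the second are evaluated by the
    counit, which leaves [id ⊗ ε] and [id ⊗ dbar]. *)
Lemma omega_pure (t : H ** H) :
  let W := Tpair (pi1 ;; zT) (pi2 ;; iota H) in
  W (tan_base t) = pi1 (tactr M (counit H) t : H) /\
  W (tan_d t) = tmap (hom_id M) (dbar H) t.
Proof.
move=> W.
have W1 y : W (Tm pi1 y) = pi1 (zT y).
  exact: (congr1 (fun h : _ ~> T H => h y) (Tpair1 (pi1 ;; zT) (pi2 ;; iota H))).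
have W2 y : W (Tm pi2 y) = pi2 (iota H y).
  exact: (congr1 (fun h : _ ~> T H => h y) (Tpair2 (pi1 ;; zT) (pi2 ;; iota H))).
have b1 x : W (tan_base (pi1 x)) = pi1 x by rewrite -Tm_base W1 zT_base.
have b2 x : W (tan_base (pi2 x)) = scal _ (gone H x).
  by rewrite -Tm_base W2 iota_base comap_scal.
have d1 x : W (tan_d (pi1 x)) = 0 by rewrite -Tm_d W1 zT_d comap0.
have d2 x : W (tan_d (pi2 x)) = pi2 (dbar H x : Te H).
  by rewrite -Tm_d W2 iota_d.
elim/tensor_ind: t => [x y||t u [IHt IHt'] [IHu IHu']|c t [IHt IHt']].
- rewrite tactrE tmapE [tpure x y]apureE tan_baseM tan_dM.
  rewrite comapD !comapM b1 b2 d1 d2 mulr0 addr0; split; last by rewrite -apureE.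
  by rewrite comap_scal mulrC.
- rewrite !hom0 comap0 -[0 in LHS](rmorph0 (scal (H ** H))).
  split.
    by rewrite tan_base_scal comap_scal rmorph0.
  by rewrite -[0 in LHS](rmorph0 (scal (H ** H))) tan_d_scal comap0.
- by rewrite tan_baseD tan_dD !homD !comapD IHt IHu IHt' IHu'.
- rewrite !homZ amodZ prodZ tan_baseM tan_base_scal tan_dZ !comapM !comap_scal.
  by rewrite IHt IHt'; split=> //; exact: esym (prodZ _ _).
Qed.

Lemma omega_inv_field (A : calg R) (f : A ~> Te H) :
  inv_field (amap (aff_id H) f ;; omega H) (hom_comp (comap_hom f) (dbar H)).
Proof.
have om (a : H) := omega_pure (gmul H a).
split=> a; rewrite !aff_compE ?Tm_base ?Tm_d.
  by rewrite (om a).1 -comultE comult_counitr [LHS]pair1E.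
rewrite (om a).2 amap_tmap tmap_comp.
by congr (tmap _ _ _); apply: homP.
Qed.

Definition comm_hom : hom M (amod (Te H ** Te H)) :=
  conv (hom_comp (comap_hom pi1) (dbar H)) (hom_comp (comap_hom pi2) (dbar H)) -
  conv (hom_comp (comap_hom pi2) (dbar H)) (hom_comp (comap_hom pi1) (dbar H)).

Lemma comm_hom_derivation : @unit_derivation R H (Te H ** Te H) comm_hom.
Proof. exact: inv_field_comm_derivation (omega_inv_field _) (omega_inv_field _). Qed.

Definition te_bracket : Te H ** Te H ~> Te H := Te_lift comm_hom_derivation.

(** The equation [il_bracket_omega] alone forces this value, since an invariant field determines its
    linear map. *)
Lemma il_bracketE (L : internal_lie H) a : il_bracket L (dbar H a) = comm_hom a.
Proof.
have /inv_field_bracket E := il_bracket_omega L.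
have := E _ _ _ (omega_inv_field _) (omega_inv_field _) (omega_inv_field _).
by move=> /(congr1 (fun h : hom _ _ => h a)).
Qed.

Lemma te_bracket_omega :
  plivf_bracket (amap (aff_id H) pi1 ;; omega H) (amap (aff_id H) pi2 ;; omega H)
    (amap (aff_id H) te_bracket ;; omega H).
Proof.
apply/(inv_field_bracket (omega_inv_field _) (omega_inv_field _) (omega_inv_field _)).
by apply: homP => a; exact: (Te_liftE comm_hom_derivation a).
Qed.

Definition te_internal_lie : internal_lie H :=
  InternalLie (te_zero_iota H) (te_add_iota H) (te_lift_iota H) (te_lift_pT H)
    (te_lift_proj H) te_bracket_omega.

End LeftInvariant.

(** * The structure of an internal Lie algebra is forced on the elements [dbar a] *)

Section InternalLieUnique.
Context (R : comPzRingType) (H : aff_group R) (L : internal_lie H).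
Notation Te := (Te H).
Notation d := (il_diff L).

Lemma il_zeroE a : dzero d (dbar H a) = 0.
Proof.
have := congr1 (fun h : _ ~> T H => h (tan_d a)) (il_zero_iota L).
by rewrite !aff_compE zT_d comap0.
Qed.

Lemma il_addE a : dadd d (dbar H a) = pi1 (dbar H a : Te) + pi2 (dbar H a : Te).
Proof.
have [e E] := il_add_iota L.
have := congr1 (fun h : _ ~> T H => h (tan_d a)) E.
rewrite !aff_compE iota_d sT_d comapD => ->; congr (_ + _).
  exact: (congr1 (fun h : _ ~> T H => h (tan_d a)) (pb_pair1 e)).
exact: (congr1 (fun h : _ ~> T H => h (tan_d a)) (pb_pair2 e)).
Qed.

Lemma il_lift_base a : il_lift L (tan_base (dbar H a : Te)) = 0.
Proof.
have := congr1 (fun h : _ ~> Te => h (dbar H a)) (il_lift_pT L).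
by rewrite !aff_compE il_zeroE comap0.
Qed.

Lemma il_lift_d a : il_lift L (tan_d (dbar H a : Te)) = dbar H a.
Proof.
have := congr1 (fun h : _ ~> T (T H) => h (tan_d (tan_d a))) (il_lift_iota L).
by rewrite !aff_compE Tm_d lT_d_d.
Qed.

(* The inverse of ⟨p, p̂⟩ is (z × λ) T+, so the vertical lift determines p̂. *)
Lemma il_projE a : dproj d (dbar H a) = tan_d (dbar H a : Te).
Proof.
pose W : Te ** Te ~> T (Te ** Te) := Tpair (pi1 ;; zT) (pi2 ;; il_lift L).
have W1 y : W (Tm pi1 y) = pi1 (zT y).
  exact: (congr1 (fun h : _ ~> T Te => h y) (Tpair1 (pi1 ;; zT) (pi2 ;; il_lift L))).
have W2 y : W (Tm pi2 y) = pi2 (il_lift L y).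
  exact: (congr1 (fun h : _ ~> T Te => h y) (Tpair2 (pi1 ;; zT) (pi2 ;; il_lift L))).
have b1 x : W (tan_base (pi1 x)) = pi1 x by rewrite -Tm_base W1 zT_base.
have b2 x : W (tan_base (pi2 x)) = pi2 (il_lift L (tan_base x)).
  by rewrite -Tm_base W2.
have d1 x : W (tan_d (pi1 x)) = 0 by rewrite -Tm_d W1 zT_d comap0.
have d2 x : W (tan_d (pi2 x)) = pi2 (il_lift L (tan_d x)) by rewrite -Tm_d W2.
pose m := W ;; Tm (dadd d).
have mP : m ;; pair pT (dproj d) = aff_id _.
  apply: prod_ext; apply: Te_ext => b; rewrite !aff_compE.
    rewrite pair1E pTE Tm_base il_addE tan_baseD comapD b1 b2.
    by rewrite il_lift_base (comap0 pi2) aff_idE addr0.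
  rewrite pair2E.
  have := congr1 (fun h : _ ~> Te => h (dbar H b)) (Tdadd_dproj d).
  rewrite !aff_compE => ->; rewrite il_addE comapD pair1E pair2E comapD !aff_compE W1 W2.
  have := congr1 (fun h : _ ~> Te => h (dbar H b)) (zT_dproj d).
  rewrite !aff_compE => ->; rewrite il_zeroE !comap0 add0r.
  have := congr1 (fun h : _ ~> Te => h (dbar H b)) (il_lift_dproj L).
  by rewrite !aff_compE => ->.
have [g [Pg gP]] := dproj_iso d.
have mg : m = g.
  have -> : m = m ;; (pair pT (dproj d) ;; g) by rewrite Pg; apply: affP.
  by rewrite aff_compA mP; apply: affP.
have := congr1 (fun h : _ ~> T Te => h (tan_d (dbar H a : Te))) Pg.
rewrite -mg !aff_compE Tm_d il_addE tan_dD comapD d1 d2 add0r.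
by rewrite il_lift_d pair2E.
Qed.

End InternalLieUnique.

Lemma tpure0l (R : comPzRingType) (M N : lmodType R) (n : N) :
  tpure (0 : M) n = 0.
Proof. by have := tpureZl 0 (0 : M) n; rewrite !scale0r. Qed.

(** * The coLie algebra on the cotangent module *)

Section Cotangent.
Context (R : comPzRingType) (H : aff_group R).
Notation Te := (Te H).

(** A copy of [I/I²] for the augmentation ideal [I], realised as a submodule of [Te] instead of a
    quotient. *)
Definition cotangent_pred : {pred amod Te} := fun x => `[< exists a, x = dbar H a >].

Fact cotangent_submod_closed : submod_closed cotangent_pred.
Proof.
split=> [|c x y /asboolP[a ->] /asboolP[b ->]]; apply/asboolP.
  by exists 0; rewrite hom0.
by exists (c *: a + b); rewrite linearP.
Qed.

HB.instance Definition _ := GRing.isSubmodClosed.Build R (amod Te)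
  cotangent_pred cotangent_submod_closed.

Record cotangent := Cotangent {
  cotangent_val :> amod Te;
  cotangentP : cotangent_val \in cotangent_pred
}.

HB.instance Definition _ := [isSub for cotangent_val].
HB.instance Definition _ := [Choice of cotangent by <:].
HB.instance Definition _ := [SubChoice_isSubLmodule of cotangent by <:].

Definition cot_incl : hom cotangent (amod Te) :=
  @mk_hom R cotangent (amod Te) cotangent_val (fun a x y => erefl).

Lemma cot_d_subproof a : dbar H a \in cotangent_pred.
Proof. by apply/asboolP; exists a. Qed.

Fact cot_d_linear : linear (fun a => Cotangent (cot_d_subproof a)).
Proof. by move=> c a b; apply: val_inj; exact: (linearP (dbar H) c a b). Qed.

Definition cot_d : hom (amod H) cotangent := mk_hom cot_d_linear.

Lemma cot_d_surj (x : cotangent) : exists a, x = cot_d a.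
Proof.
by have /asboolP[a xa] := cotangentP x; exists a; apply: val_inj.
Qed.

(** The map [x ↦ te_lift (tan_d x)] extracts the degree one part of [x]; it is a derivation along
    [te_zero], the constant term. *)
Lemma te_lift_cotangent (x : Te) : (te_lift H (tan_d x) : amod Te) \in cotangent_pred.
Proof.
apply/asboolP; elim/Te_ind: x => [a|r|x y [a xa] [b yb]|x y [a xa] [b yb]].
- by exists a; rewrite te_lift_d.
- by exists 0; rewrite tan_d_scal comap0 hom0.
- by exists (a + b); rewrite tan_dD comapD xa yb homD.
- have liftE w : te_lift H (tan_base w) = scal Te (te_zero H w).
    exact: (congr1 (fun h : _ ~> Te => h w) (te_lift_pT H)).
  (* The Leibniz rule, each factor weighted by the constant term of the other. *)
  exists (te_zero H x *: b + te_zero H y *: a).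
  by rewrite tan_dM comapD !comapM xa yb !liftE homD !homZ.
Qed.

Fact cot_proj_linear : linear (fun x : amod Te => Cotangent (te_lift_cotangent x)).
Proof.
move=> c x y; apply: val_inj.
rewrite -[LHS]/(te_lift H (tan_d (scal Te c * (x : Te) + (y : Te)))).
by rewrite tan_dD tan_dZ comapD comapM comap_scal.
Qed.

Definition cot_proj : hom (amod Te) cotangent := mk_hom cot_proj_linear.

Lemma cot_projE a : cot_proj (dbar H a) = cot_d a.
Proof. by apply: val_inj; exact: te_lift_d a. Qed.

(** Applying the retraction [cot_proj] in both factors lands in [cotangent ⊗ cotangent] without
    choosing a preimage. *)
Definition cot_bracket : hom cotangent (tensor cotangent cotangent) :=
  hom_comp (tmap cot_proj cot_proj)
    (hom_comp (of_prod Te Te) (hom_comp (comap_hom (te_bracket H)) cot_incl)).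

(** As multiplication is commutative, exchanging the two projections in the convolution exchanges
    the tensor factors. *)
Lemma comm_homE a (t := tmap (dbar H) (dbar H) (comult H a)) :
  comm_hom H a = to_prod Te Te (t - tswap _ t).
Proof.
rewrite hom_addE hom_oppE !convE homB /t; congr (_ - _);
  elim/tensor_ind: (comult H a) => [x y||u v IHu IHv|c u IHu];
  rewrite ?hom0 ?homD ?homZ ?IHu ?IHv // tmapE ?tswapE mul_homsE.
  by rewrite -apureE.
by rewrite mulrC -apureE.
Qed.

Lemma tswap_tmap (M N : lmodType R) (f : hom M N) (t : tensor M M) :
  tswap _ (tmap f f t) = tmap f f (tswap _ t).
Proof.
elim/tensor_ind: t => [x y||t u IHt IHu|c t IHt].
- by rewrite !(tmapE, tswapE).
- by rewrite !hom0.
- by rewrite !homD IHt IHu.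
- by rewrite !homZ IHt.
Qed.

Lemma cot_bracketE a (t := tmap cot_d cot_d (comult H a)) :
  cot_bracket (cot_d a) = t - tswap _ t.
Proof.
transitivity (tmap cot_proj cot_proj (of_prod Te Te (comm_hom H a))).
  exact: (congr1 (fun y => tmap cot_proj cot_proj (of_prod Te Te y))
    (Te_liftE (comm_hom_derivation H) a)).
rewrite comm_homE -[of_prod _ _ _]/(tmap (dbar H) (dbar H) (comult H a) -
  tswap _ (tmap (dbar H) (dbar H) (comult H a))).
have e : tmap cot_proj cot_proj (tmap (dbar H) (dbar H) (comult H a)) = t.
  by rewrite tmap_comp; congr (tmap _ _ _); apply: homP => b; exact: cot_projE.
by rewrite homB -tswap_tmap e.
Qed.

Fact cot_bracket_alt x : exists t, cot_bracket x = t - tswap _ t.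
Proof.
by have [a ->] := cot_d_surj x; exists (tmap cot_d cot_d (comult H a));
  rewrite cot_bracketE.
Qed.

(** The Jacobi sum, where [a], [b], [c] are the cyclic shifts of one tensor and [p], [q], [r] those
    of another. *)
Lemma cyclic_sum0 (V : zmodType) (a b c p q r : V) :
  (a - p - (c - q)) + (b - q - (a - r)) + (c - r - (b - p)) = 0.
Proof.
have e (k1 k2 k3 k4 : V) : k1 - k2 - (k3 - k4) = (k1 + k4) - (k3 + k2).
  by rewrite opprB opprD addrACA [- k2 - k3]addrC.
rewrite !e [b + r]addrC (addrC c p) [X in X + _]addrC.
by rewrite (addrC p c) (addrC r b) subrKA subrKA subrr.
Qed.

Lemma tcycleK (M : lmodType R) (w : tensor M (tensor M M)) :
  tcycle M (tcycle M (tcycle M w)) = w.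
Proof.
elim/tensor_ind: w => [x t||t u IHt IHu|c t IHt].
- elim/tensor_ind: t => [y z||t u IHt IHu|c t IHt].
  + by rewrite !tcycleE.
  + by rewrite tpure0r !hom0.
  + by rewrite tpureDr !homD IHt IHu.
  + by rewrite tpureZr !homZ IHt.
- by rewrite !hom0.
- by rewrite !homD IHt IHu.
- by rewrite !homZ IHt.
Qed.

(** The two terms of the outer [1 - τ] involve [(id ⊗ Δ)Δ] and [(Δ ⊗ id)Δ]; coassociativity
    expresses all four summands through one iterated coproduct, up to permuting factors. *)
Lemma cot_bracket2E a :
  exists t t', tmap (hom_id cotangent) cot_bracket (cot_bracket (cot_d a)) =
    t - t' - (tcycle _ (tcycle _ t) - tcycle _ t').
Proof.
pose E := tmap cot_d (tmap cot_d cot_d).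
pose s := tmap (hom_id cotangent) (tswap cotangent).
have e1 u : tmap (hom_id cotangent) cot_bracket (tmap cot_d cot_d u) =
    E (tmap (hom_id (amod H)) (comult H) u) -
    s (E (tmap (hom_id (amod H)) (comult H) u)).
  elim/tensor_ind: u => [x y||u v IHu IHv|c u IHu].
  - by rewrite !tmapE cot_bracketE tpureBr.
  - by rewrite !hom0 subr0.
  - by rewrite !homD IHu IHv opprD addrACA.
  - by rewrite !homZ IHu scalerBr.
have e2 u : tmap (hom_id cotangent) cot_bracket (tswap _ (tmap cot_d cot_d u)) =
    tcycle _ (tcycle _ (E (tassoc _ _ _ (tmap (comult H) (hom_id (amod H)) u)))) -
    tcycle _ (s (E (tassoc _ _ _ (tmap (comult H) (hom_id (amod H)) u)))).
  elim/tensor_ind: u => [x y||u v IHu IHv|c u IHu].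
  - rewrite tmapE tswapE !tmapE cot_bracketE.
    elim/tensor_ind: (comult H x) => [v w||t u IHt IHu|c t IHt].
    + by rewrite /E /s !(tassocE, tmapE, tswapE, tcycleE) tpureBr.
    + by rewrite tpure0l !hom0 !subr0 tpure0r.
    + by rewrite tpureDl !homD opprD addrACA tpureDr IHt IHu opprD addrACA.
    + by rewrite tpureZl !homZ -scalerBr tpureZr IHt scalerBr.
  - by rewrite !hom0 subr0.
  - by rewrite !homD IHu IHv opprD addrACA.
  - by rewrite !homZ IHu scalerBr.
pose w := tmap (hom_id (amod H)) (comult H) (comult H a).
(* The witnesses are the image of the iterated coproduct and the same tensor with its last two
   factors swapped. *)
by exists (E w), (s (E w)); rewrite cot_bracketE homB e1 e2 comult_coassoc.
Qed.

Fact cot_bracket_jacobi x :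
  let t := tmap (hom_id cotangent) cot_bracket (cot_bracket x) in
  t + tcycle _ t + tcycle _ (tcycle _ t) = 0.
Proof.
have [a ->] := cot_d_surj x; have [t [t' E]] := cot_bracket2E a.
by move=> u; rewrite {}/u E !homB !tcycleK; exact: cyclic_sum0.
Qed.

Definition cot_coLie : coLie R := CoLie cot_bracket_alt cot_bracket_jacobi.

Definition Te_to_Sym : Te ~> Sym cotangent := sym_lift cot_incl.

Lemma Te_to_SymE a : Te_to_Sym (sym_gen (cot_d a)) = dbar H a.
Proof. exact: sym_liftE. Qed.

Fact Sym_to_Te_derivation :
  @unit_derivation R H (Sym cotangent) (fun a => sym_gen (cot_d a)).
Proof.
have [dD dZ dM] := dbar_derivation H.
split=> [a b|r a|a b].
- exact: (homD (hom_comp sym_gen cot_d) a b).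
- exact: (homZ (hom_comp sym_gen cot_d) r a).
have -> : cot_d (a * b : H) = gone H a *: cot_d b + gone H b *: cot_d a.
  by apply: val_inj; exact: dM.
by rewrite homD !homZ.
Qed.

Lemma Te_to_Sym_iso : aff_iso Te_to_Sym.
Proof.
exists (Te_lift Sym_to_Te_derivation); split.
  by apply: Te_ext => a; rewrite aff_compE Te_liftE Te_to_SymE.
apply: sym_ext => m; have [a ->] := cot_d_surj m.
by rewrite aff_compE Te_to_SymE Te_liftE.
Qed.

(** By [il_projE] and [il_bracketE] the relevant values do not depend on [L], so one coLie algebra
    serves all of them. *)
Lemma cot_corresponds (L : internal_lie H) :
  corresponds_to (il_diff L) (il_bracket L) cot_coLie.
Proof.
exists Te_to_Sym; split; first exact: Te_to_Sym_iso.
  apply: sym_ext => m; have [a ->] := cot_d_surj m.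
  by rewrite !aff_compE sym_projE Tm_d Te_to_SymE il_projE.
apply: sym_ext => m; have [a ->] := cot_d_surj m.
rewrite !aff_compE Te_to_SymE il_bracketE [sym_bracket _ _]sym_liftE.
rewrite [RHS]amap_tmap tmap_comp [cobr _ _]cot_bracketE homB -tswap_tmap.
rewrite tmap_comp comm_homE.
by congr (_ - tswap _ _); congr (tmap _ _ _); apply: homP => b; exact: esym (Te_to_SymE b).
Qed.

End Cotangent.

(** * The vertical lift of [Sym M] and its linear elements *)

Section SymLinear.
Context (R : comPzRingType) (M : lmodType R).
Notation S := (Sym M).

Fact sym_lift0_linear : linear (fun m : M => Dual 0 (sym_gen m : S) : amod (dual S)).
Proof.
move=> a m n; rewrite linearP !amodZ.
rewrite [RHS]/(dual_add (dual_mul _ _) _) /dual_add /dual_mul /=.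
by rewrite !(mulr0, mul0r, addr0).
Qed.

(* The vertical lift of sym_diff M. *)
Definition sym_vlift : S ~> T S := of_dual (sym_lift (mk_hom sym_lift0_linear)).

Lemma sym_vlift_base m : sym_vlift (tan_base (sym_gen m : S)) = 0.
Proof. by rewrite of_dual_base sym_liftE. Qed.

Lemma sym_vlift_d m : sym_vlift (tan_d (sym_gen m : S)) = sym_gen m.
Proof. by rewrite of_dual_d sym_liftE. Qed.

Lemma sym_vlift_pT : sym_vlift ;; pT = aff_to1 S ;; sym_zero M.
Proof.
apply: sym_ext => m; rewrite !aff_compE pTE sym_vlift_base sym_zeroE.
by rewrite (comap0 (aff_to1 S)).
Qed.

(** The same degree one extraction as on [Te]: a derivation along the augmentation keeps its values
    among the generators. *)
Lemma sym_vlift_linear (x : S) : exists m, sym_vlift (tan_d x) = sym_gen m.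
Proof.
have vliftE w : sym_vlift (tan_base w) = scal S (sym_zero M w).
  exact: (congr1 (fun h : _ ~> S => h w) sym_vlift_pT).
elim/aclass_ind: x; elim=> [m|r|t [m tm] u [n un]|t [m tm] u [n un]].
- by exists m; exact: sym_vlift_d.
- by exists 0; rewrite -[aclass _ _]/(scal S r) tan_d_scal comap0 hom0.
- by exists (m + n); rewrite aclassD tan_dD comapD tm un homD.
- exists (sym_zero M (aclass _ t) *: n + sym_zero M (aclass _ u) *: m).
  by rewrite aclassM tan_dM comapD !comapM tm un !vliftE homD !homZ.
Qed.

End SymLinear.

(* R^o and amod (aff1 R) are the same module, but not convertible. *)
Definition of_reg (R : comPzRingType) : hom R^o (amod (aff1 R)) :=
  @mk_hom R R^o (amod (aff1 R)) id (fun a x y => erefl).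

Definition to_reg (R : comPzRingType) : hom (amod (aff1 R)) R^o :=
  @mk_hom R (amod (aff1 R)) R^o id (fun a x y => erefl).

(** * Left-invariant derivations and derivations along the counit *)

Section PointDerivation.
Context (R : comPzRingType) (H : aff_group R).
Notation Te := (Te H).
Notation M := (amod H).

Definition lider_of_conv (D : hom M R^o) : hom M M := hom_comp (tactr M D) (comult H).

Lemma lider_of_convE D a : lider_of_conv D a = tactr M D (comult H a).
Proof. by []. Qed.

(** The counit on the first factor and [D] on the second may be applied in either order; doing the
    counit first, its law leaves [D a]. *)
Lemma counit_lider_of D a : counit H (lider_of_conv D a) = D a.
Proof.
have e t : counit H (tactr M D t) = D (tactl M (counit H) t).
  elim/tensor_ind: t => [x y||t u IHt IHu|c t IHt].
  - by rewrite tactrE tactlE !homZ; exact: mulrC.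
  - by rewrite !hom0.
  - by rewrite !homD IHt IHu.
  - by rewrite !homZ IHt.
by rewrite lider_of_convE e comult_counitl.
Qed.

Lemma lider_of_invariant D a : comult H (lider_of_conv D a) =
  tmap (hom_id M) (lider_of_conv D) (comult H a).
Proof.
rewrite -[RHS](tmap_comp (hom_id M) (comult H) (hom_id M) (tactr M D)).
rewrite -comult_coassoc lider_of_convE.
elim/tensor_ind: (comult H a) => [x y||t u IHt IHu|c t IHt].
- rewrite tactrE tmapE homZ.
  elim/tensor_ind: (comult H x) => [v w||t u IHt IHu|c t IHt].
  + by rewrite tassocE tmapE tactrE tpureZr.
  + by rewrite tpure0l !hom0 scaler0.
  + by rewrite tpureDl !homD scalerDr IHt IHu.
  + by rewrite tpureZl !homZ -IHt !scalerA mulrC.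
- by rewrite !hom0.
- by rewrite !homD IHt IHu.
- by rewrite !homZ IHt.
Qed.

Lemma lider_of_derivation (D : hom M R^o) :
    @unit_derivation R H (aff1 R) D ->
  forall x y : H, lider_of_conv D (x * y : H) =
    x * (lider_of_conv D y : H) + y * (lider_of_conv D x : H).
Proof.
(* [q] is the vector field on the group translating the tangent vector [D]. As an algebra map on
   [T H] with [tan_base a ↦ a], it carries the Leibniz rule of [tan_d] to the operator. *)
move=> DP x y; pose q := pair (aff_id H) (aff_to1 H ;; Te_lift DP) ;; omega H.
have om (a : H) := omega_pure (gmul H a).
have qb a : q (tan_base a) = a.
  by rewrite !aff_compE Tm_base (om a).1 -comultE comult_counitr pair1E.
have qd a : q (tan_d a) = lider_of_conv D a.
  rewrite !aff_compE Tm_d (om a).2 -comultE lider_of_convE.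
  elim/tensor_ind: (comult H a) => [u v||t u IHt IHu|c t IHt].
  - by rewrite tmapE tactrE [LHS]pairE aff_compE Te_liftE mulrC.
  - by rewrite !hom0 comap0.
  - by rewrite !homD comapD IHt IHu.
  - by rewrite !homZ comap_prodZ IHt.
by rewrite -!qd tan_dM comapD !comapM !qb.
Qed.

(** Left invariance gives [(id ⊗ εf)Δ a = (id ⊗ ε)Δ(f a)], which is [f a]; hence [f] is determined
    by its value at the unit. *)
Lemma counit_lider (f : LIDer H) a :
  lider_of_conv (hom_comp (counit H) (lider f)) a = lider f a.
Proof.
have /asboolP[_ fD] := liderP f.
have {fD} fD : comult H (f a) = tmap (hom_id M) f (comult H a) by exact: fD.
rewrite -[RHS]comult_counitr fD lider_of_convE.
elim/tensor_ind: (comult H a) => [x y||t u IHt IHu|c t IHt].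
- by rewrite tmapE !tactrE.
- by rewrite !hom0.
- by rewrite !homD IHt IHu.
- by rewrite !homZ IHt.
Qed.

Lemma lider_counit_derivation (f : LIDer H) :
  @unit_derivation R H (aff1 R) (hom_comp (counit H) (lider f)).
Proof.
have /asboolP[fM _] := liderP f.
split=> [a b|r a|a b].
- exact: (homD (hom_comp (counit H) (lider f)) a b).
- exact: (homZ (hom_comp (counit H) (lider f)) r a).
- rewrite -[LHS]/(gone H (f (a * b : H))) fM comapD !comapM; exact: erefl.
Qed.

Definition lider_of (D : hom M R^o) (DP : @unit_derivation R H (aff1 R) D) :
  LIDer H.
Proof.
refine (@MkLIDer R H (lider_of_conv D) _).
apply/asboolP; split; first exact: lider_of_derivation.
exact: lider_of_invariant.
Defined.

Lemma lider_counit_inj (f g : LIDer H) :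
  (forall a, counit H (f a) = counit H (g a)) -> f = g.
Proof.
move=> fg; apply: lider_ext => a; rewrite -!counit_lider !lider_of_convE.
by congr (tactr M _ _); apply: homP => b; exact: fg.
Qed.

End PointDerivation.

(** * Linear forms on any corresponding coLie algebra as left-invariant derivations *)

Section Duality.
Context (R : comPzRingType) (H : aff_group R) (L : internal_lie H) (C : coLie R).
Notation Te := (Te H).
Notation M := (amod H).
Notation S := (Sym C).
Context (phi : Te ~> S) (psi : S ~> Te).
Context (phiK : phi ;; psi = aff_id Te) (psiK : psi ;; phi = aff_id S).
Context (phi_linear : diff_linear (il_diff L) (sym_diff C) phi).
Context (phi_bracket : il_bracket L ;; phi = amap phi phi ;; sym_bracket (cobr C)).

Lemma phi_psi x : phi (psi x) = x.
Proof. exact: (congr1 (fun h : _ ~> Te => h x) phiK). Qed.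

Lemma psi_phi x : psi (phi x) = x.
Proof. exact: (congr1 (fun h : _ ~> S => h x) psiK). Qed.

Lemma phi_zero : dzero (il_diff L) ;; phi = sym_zero C.
Proof.
apply: sym_ext => m; rewrite aff_compE sym_zeroE.
(* The axiom [zT_dproj] expresses zero through the projection, so linearity of [phi] already makes
   it preserve zero. *)
have zE (x : Te) : dzero (il_diff L) x = dzero (il_diff L) (zT (dproj (il_diff L) x)).
  have := congr1 (fun h : _ ~> Te => h x) (zT_dproj (il_diff L)).
  by rewrite !aff_compE => ->; rewrite comap_scal.
have := congr1 (fun h : _ ~> S => h (sym_gen m)) phi_linear.
rewrite !aff_compE [dproj (sym_diff C) _]sym_projE Tm_d zE => <-.
by rewrite zT_d comap0.
Qed.

(* A linear isomorphism of differential objects commutes with the vertical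
   lifts, since these are ⟨!0, id⟩⟨p, p̂⟩^{-1}. *)
Lemma phi_lift : il_lift L ;; Tm phi = phi ;; sym_vlift C.
Proof.
have [g [Pg gP]] := dproj_iso (sym_diff C).
suff e : il_lift L ;; Tm phi ;; pair pT (dproj (sym_diff C)) =
         phi ;; sym_vlift C ;; pair pT (dproj (sym_diff C)).
  have := congr1 (fun h => h ;; g) e; rewrite -!aff_compA Pg => E.
  by apply: affP => x; exact: (congr1 (fun h : _ ~> T S => h x) E).
apply: prod_ext; apply: sym_ext => m; rewrite !aff_compE ?pair1E ?pair2E.
  rewrite pTE Tm_base sym_vlift_base comap0.
  have := congr1 (fun h : _ ~> Te => h (phi (sym_gen m))) (il_lift_pT L).
  rewrite !aff_compE pTE => ->.
  have := congr1 (fun h : _ ~> S => h (sym_gen m)) phi_zero.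
  by rewrite aff_compE sym_zeroE => ->; rewrite comap0.
have := congr1 (fun h : _ ~> S => h (sym_gen m)) phi_linear.
rewrite !aff_compE => ->.
have := congr1 (fun h : _ ~> Te => h (phi (sym_gen m))) (il_lift_dproj L).
rewrite !aff_compE => ->.
by rewrite [dproj (sym_diff C) _]sym_projE sym_vlift_d.
Qed.

(** [dbar a] is the lift of its own differential; [phi_lift] transports this to [Sym C], where lifts
    of differentials are linear. *)
Lemma psi_dbar a : exists m, psi (dbar H a) = sym_gen m.
Proof.
have [m E] := sym_vlift_linear (psi (dbar H a)); exists m; rewrite -E.
have := congr1 (fun h : _ ~> T S => h (tan_d (psi (dbar H a)))) phi_lift.
by rewrite !aff_compE Tm_d phi_psi il_lift_d => /(congr1 psi); rewrite psi_phi.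
Qed.

Definition sym_point (alpha : hom C R^o) : aff1 R ~> S :=
  sym_lift (hom_comp (of_reg R) alpha).

Lemma sym_pointE alpha m : sym_point alpha (sym_gen m) = alpha m.
Proof. exact: (sym_liftE (hom_comp (of_reg R) alpha) m). Qed.

Definition point_hom (alpha : hom C R^o) : hom M R^o :=
  hom_comp (to_reg R) (hom_comp (comap_hom (sym_point alpha))
    (hom_comp (comap_hom psi) (dbar H))).

Lemma point_homE alpha a m : psi (dbar H a) = sym_gen m -> point_hom alpha a = alpha m.
Proof.
move=> E; rewrite -[LHS]/(sym_point alpha (psi (dbar H a))) E.
exact: sym_pointE.
Qed.

Lemma point_derivation alpha : @unit_derivation R H (aff1 R) (point_hom alpha).
Proof. exact: (comp_unit_derivation (sym_point alpha ;; psi)). Qed.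

Lemma sym_bracket_tens_form alpha beta (t : tensor C C) :
  pair (sym_point alpha) (sym_point beta) (tmap sym_gen sym_gen t) =
  tens_form alpha beta t.
Proof.
elim/tensor_ind: t => [x y||t u IHt IHu|c t IHt].
- by rewrite tmapE tens_formE [LHS]pairE; rewrite !sym_pointE.
- by rewrite !hom0 comap0.
- by rewrite !homD comapD IHt IHu.
- by rewrite !homZ comap_prodZ IHt.
Qed.

(** The compatibility of [phi] with the brackets, evaluated at the pair of points [alpha], [beta]:
    the dual bracket becomes the convolution commutator. *)
Lemma point_bracket alpha beta a : point_hom (dual_lie alpha beta) a =
  tens_form (point_hom alpha) (point_hom beta) (comult H a) -
  tens_form (point_hom beta) (point_hom alpha) (comult H a).
Proof.
have [m E] := psi_dbar a; rewrite (point_homE _ E) dual_lieE -sym_bracket_tens_form.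
rewrite -[tmap sym_gen sym_gen _](sym_liftE (mk_hom (sym_bracket_linear (cobr C)))).
rewrite -[sym_lift _ _]/(sym_bracket (cobr C) (sym_gen m)) -E.
have := congr1 (fun h : _ ~> S => h (psi (dbar H a))) phi_bracket.
rewrite !aff_compE phi_psi il_bracketE => e.
(* Points of [Sym C] are rewritten as points of [Te] followed by [phi], so that [phi_bracket]
   applies. *)
have -> : pair (sym_point alpha) (sym_point beta) =
    pair (sym_point alpha ;; psi) (sym_point beta ;; psi) ;; amap phi phi.
  by apply: prod_ext; apply: affP => x;
     rewrite /amap; do 3!rewrite ?aff_compE ?pair1E ?pair2E; rewrite psi_phi.
rewrite aff_compE -e comm_homE.
set p := pair _ _; have pB (t u : tensor (amod Te) (amod Te)) :
    p (to_prod Te Te (t - u)) = p t - p u by exact: rmorphB.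
rewrite pB {pB}; congr (_ - _);
  elim/tensor_ind: (comult H a) => [x y||t u IHt IHu|c t IHt];
  rewrite ?hom0 ?homD ?homZ ?comap0 ?comapD ?comap_prodZ ?IHt ?IHu // tmapE ?tswapE
    tens_formE.
  by rewrite [LHS]pairE.
by rewrite [LHS]pairE mulrC.
Qed.

Lemma point_lie_isomorphic : lie_isomorphic (coLie_dual C) (LIDer_lie H).
Proof.
pose F (alpha : hom C R^o) : LIDer H := lider_of (point_derivation alpha).
have FtactrE alpha a : F alpha a = tactr M (point_hom alpha) (comult H a) by [].
have FE alpha a : counit H (F alpha a) = point_hom alpha a.
  exact: counit_lider_of.
clearbody F.
have counitB x y : counit H (x - y) = counit H x - counit H y by exact: homB.
have Flin : @linear_for R (coLie_dual C) (LIDer_lie H) *:%R F.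
  move=> c alpha beta; apply: lider_counit_inj => a.
  have [m E] := psi_dbar a.
  transitivity (counit H (c *: F alpha a + F beta a)); last by [].
  by rewrite FE homD homZ !FE !(point_homE _ E).
(* Composition of left-invariant operators is convolution of their values at the unit, in the same
   order. *)
have FK alpha beta a : counit H (F alpha (F beta a)) =
    tens_form (point_hom alpha) (point_hom beta) (comult H a).
  rewrite [F beta a]FtactrE.
  elim/tensor_ind: (comult H a) => [x y||t u IHt IHu|k t IHt].
  - by rewrite tactrE tens_formE !homZ FE mulrC.
  - by rewrite !hom0.
  - by rewrite !homD IHt IHu.
  - by rewrite !homZ IHt.
exists (mk_hom Flin); split; last first.
  move=> alpha beta; apply: lider_counit_inj => a.
  rewrite [LHS]FE point_bracket -!FK.
  exact: esym (counitB _ _).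
(* The inverse: [f] gives a derivation along the counit, hence a point of [Te]; transported by
   [phi], it is restricted to the generators of [Sym C]. *)
pose G (f : LIDer H) : hom C R^o :=
  hom_comp (to_reg R) (hom_comp
    (comap_hom (Te_lift (lider_counit_derivation f) ;; phi)) sym_gen).
have GE f m : G f m = Te_lift (lider_counit_derivation f) (phi (sym_gen m)) by [].
exists G => [alpha|f].
  apply: homP => m; rewrite GE.
  have <- : sym_point alpha ;; psi = Te_lift (lider_counit_derivation (F alpha)).
    by apply: Te_ext => a; rewrite Te_liftE; exact: esym (FE alpha a).
  by rewrite aff_compE psi_phi sym_pointE.
apply: lider_counit_inj => a; rewrite [LHS]FE.
have [m E] := psi_dbar a; rewrite (point_homE _ E) GE -E phi_psi.
exact: (Te_liftE (lider_counit_derivation f) a).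
Qed.

End Duality.

(** The existence claims for [L] and [C] keep the universal statements from being vacuous, and the
    isomorphism holds for every choice of both. *)
Theorem theorem6p4 (R : comPzRingType) (H : aff_group R) :
  inhabited (internal_lie H) /\
  forall L : internal_lie H,
    (exists C : coLie R, corresponds_to (il_diff L) (il_bracket L) C) /\
    (forall C : coLie R, corresponds_to (il_diff L) (il_bracket L) C ->
      lie_isomorphic (coLie_dual C) (LIDer_lie H)).
Proof.
split; first exact: inhabits (te_internal_lie H).
move=> L; split; first by exists (cot_coLie H); exact: cot_corresponds.
move=> C [phi [[psi [phiK psiK]] lin br]].
exact: point_lie_isomorphic phiK psiK lin br.
Qed.
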